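(* Let $Z$ be a manifold, $1\le n\le\dim Z$, and let $\Omega$ be an $(n+1)$-form on $Z$. For $r=1,\dots,n$ let $$D_r=\Big\{(\Gamma,\mathbf{i}_\Gamma\Omega)\in L_r\ \Big|\ \Gamma\in\textstyle\bigwedge^r(TZ)\Big\},\qquad L_r=\textstyle\bigwedge^r(TZ)\times_Z\bigwedge^{n+1-r}(T^*Z).$$ Then the multi-Dirac structure $D=D_1\oplus\cdots\oplus D_n$ is integrable if and only if $\Omega$ is closed, i.e. $\mathbf{d}\Omega=0$.
   Context: All manifolds and maps are smooth. A $k$-multivector field is a section of $\bigwedge^k(TZ)$. For decomposable $\Gamma=X_1\wedge\cdots\wedge X_k$ and a form $\alpha$, $\mathbf{i}_\Gamma\alpha=\mathbf{i}_{X_k}\cdots\mathbf{i}_{X_1}\alpha$, extended linearly to all $\Gamma$; $\mathbf{i}_\Gamma\alpha=0$ if $\deg\alpha<k$. The Lie derivative along a $k$-multivector field is $\pounds_\Gamma\alpha=\mathbf{d}\mathbf{i}_\Gamma\alpha-(-1)^k\mathbf{i}_\Gamma\mathbf{d}\alpha$. The Schouten-Nijenhuis bracket is the unique $\mathbb{R}$-bilinear bracket from $k$- and $l$-multivector fields to $(k+l-1)$-multivector fields which vanishes on pairs of functions, coincides with the Lie bracket on vector fields, satisfies $[\Gamma,\Gamma']=-(-1)^{(k-1)(l-1)}[\Gamma',\Gamma]$, $[\Gamma,\Gamma'\wedge\Gamma'']=[\Gamma,\Gamma']\wedge\Gamma''+(-1)^{(k-1)l}\Gamma'\wedge[\Gamma,\Gamma'']$,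 and the graded Jacobi identity $(-1)^{(k-1)(m-1)}[\Gamma,[\Gamma',\Gamma'']]+\text{cyclic permutations}=0$ (for $\Gamma,\Gamma',\Gamma''$ of degrees $k,l,m$). For $(\Gamma,\Sigma)\in L_r$, $(\Gamma',\Sigma')\in L_s$ define $$\langle\!\langle(\Gamma,\Sigma),(\Gamma',\Sigma')\rangle\!\rangle_\pm=\tfrac12\big(\mathbf{i}_{\Gamma'}\Sigma\pm(-1)^{rs}\mathbf{i}_\Gamma\Sigma'\big)\in\textstyle\bigwedge^{n+1-r-s}(T^*Z),$$ which is $0$ when $r+s>n+1$. Multi-Courant bracket (on sections): if $r+s\le n+1$, $$[\![(\Gamma,\Sigma),(\Gamma',\Sigma')]\!]=\Big([\Gamma,\Gamma'],(-1)^{(r-1)s}\pounds_\Gamma\Sigma'+(-1)^s\pounds_{\Gamma'}\Sigma-(-1)^s\mathbf{d}\langle\!\langle(\Gamma,\Sigma),(\Gamma',\Sigma')\rangle\!\rangle_+\Big)\in L_{r+s-1},$$ and the bracket is $0$ if $r+s>n+1$. For a subbundle $V_r\subset L_r$, $(V_r)^{\perp,s}=\{(\Gamma',\Sigma')\in L_s:\langle\!\langle(\Gamma,\Sigma),(\Gamma',\Sigma')\rangle\!\rangle_-=0\ \text{for all }(\Gamma,\Sigma)\in V_r\}$. A multi-Dirac structure of degree $n$ on $Z$ is a sequence of subbundles $D_r\subset L_r$ ($r=1,\dots,n$), written $D=D_1\oplus\cdots\oplus D_n$, with $(D_r)^{\perp,s}=D_s$ for all $r,s$ with $r+s\le n+1$.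 (The sequence $D_r$ of the claim has this property for every $(n+1)$-form $\Omega$.) It is integrable if its space of sections is closed under the multi-Courant bracket: for all sections $(\Gamma,\Sigma)$ of $D_r$ and $(\Gamma',\Sigma')$ of $D_s$, $[\![(\Gamma,\Sigma),(\Gamma',\Sigma')]\!]$ is a section of $D_{r+s-1}$ (being zero if $r+s>n+1$). *)

(* Defs.v *)
From HB Require Import structures.
From mathcomp Require Import all_boot all_order all_algebra.
From mathcomp Require Import all_classical all_reals all_analysis.

Set Implicit Arguments.
Unset Strict Implicit.
Unset Printing Implicit Defensive.

Import Order.TTheory GRing.Theory Num.Theory numFieldNormedType.Exports.
Local Open Scope classical_set_scope.
Local Open Scope ring_scope.

(* Exterior algebra of R^m.

   Forms of all degrees share one type, functions on lists of vectors: a k-form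
   is a k-linear alternating function of the lists of length k, extended by 0 to
   the lists of any other length.  The exterior power of degree k of R^m is
   represented as the dual of the space of k-forms, the decomposable
   X_1 /\ ... /\ X_k being the evaluation of k-forms at [:: X_1; ...; X_k]; such
   functionals are extended by 0 to the functions that are not k-forms, so that
   Leibniz equality is equality in the exterior power.  With these conventions
   degrees such as k + l - 1 never require a cast. *)

Definition dform (R : realType) (m : nat) : Type := seq 'rV[R]_m -> R^o.
Definition mvec (R : realType) (m : nat) : Type := dform R m -> R^o.

Section Exterior.
Variables (R : realType) (m : nat).
Local Notation E := 'rV[R]_m.
Local Notation dform := (dform R m).
Local Notation mvec := (mvec R m).

Definition is_form (k : nat) (a : dform) : Prop :=
  [/\ forall s, size s != k -> a s = 0,
      forall s1 s2 (c : R) u v,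
        a (s1 ++ (c *: u + v) :: s2) = c * a (s1 ++ u :: s2) + a (s1 ++ v :: s2)
    & forall s1 s2 s3 u, a (s1 ++ u :: s2 ++ u :: s3) = 0].

Definition is_mvec (k : nat) (G : mvec) : Prop :=
  (forall (c : R) a b, is_form k a -> is_form k b ->
     G (c *: a + b) = c * G a + G b) /\
  (forall a, ~ is_form k a -> G a = 0).

Definition decomposable (s : seq E) : mvec :=
  fun a => if `[< is_form (size s) a >] then a s else 0.

Definition wedge (k l : nat) (G G' : mvec) : mvec :=
  fun a => if `[< is_form (k + l) a >]
           then G (fun t => G' (fun u => a (t ++ u))) else 0.

Definition interior (v : E) (a : dform) : dform := fun s => a (v :: s).

(* On decomposables this is i_{X_k} ... i_{X_1}: see contract_decomposable. *)
Definition contract (G : mvec) (a : dform) : dform :=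
  fun s => G (fun t => a (t ++ s)).

Lemma is_form_catr k a s : is_form (k + size s) a ->
  is_form k (fun t => a (t ++ s)).
Proof.
case=> a0 alin aalt; split=> [t tk|s1 s2 c u v|s1 s2 s3 u].
- by apply: a0; rewrite size_cat eqn_add2r.
- by rewrite -!catA !cat_cons alin.
- by rewrite -!catA /= -catA /= aalt.
Qed.

Lemma contract_decomposable k (s : seq E) (a : dform) : is_form k a ->
  contract (decomposable s) a = foldl (fun b v => interior v b) a s.
Proof.
move=> ak; apply/funext => t.
have -> : foldl (fun b v => interior v b) a s t = a (s ++ t).
  by elim: s a {ak} => //= v s IH a; rewrite IH.
rewrite /contract /decomposable; case: asboolP => // nform.
have [st|st] := eqVneq (size s + size t)%N k.
  by case: nform; apply: is_form_catr; rewrite st.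
by case: ak => -> //; rewrite size_cat.
Qed.

End Exterior.

(* All iterated directional derivatives are differentiable at each point of U;
   for open U this means that f is C^oo on U. *)
Definition smooth_on (R : realType) (m : nat) (V : normedModType R)
    (U : set 'rV[R]_m) (f : 'rV[R]_m -> V) : Prop :=
  forall (vs : seq 'rV[R]_m) (x : 'rV[R]_m), U x ->
    differentiable (foldr (fun v g y => 'D_v g y) f vs) x.

Record manifold (R : realType) (m : nat) := Manifold {
  point :> topologicalType ;
  atlas : Type ;
  dom : atlas -> set point ;
  coord : atlas -> point -> 'rV[R]_m ;
  coord_inv : atlas -> 'rV[R]_m -> point ;
  point_hausdorff : hausdorff_space point ;
  point_countable : @second_countable point ;
  dom_open : forall c, open (dom c) ;
  coord_open : forall c, open (coord c @` dom c) ;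
  coordK : forall c p, dom c p -> coord_inv c (coord c p) = p ;
  coord_continuous : forall c p, dom c p -> {for p, continuous (coord c)} ;
  coord_inv_continuous : forall c x, (coord c @` dom c) x ->
    {for x, continuous (coord_inv c)} ;
  dom_cover : forall p, exists c, dom c p ;
  transition_smooth : forall c c',
    smooth_on (coord c @` (dom c `&` dom c')) (coord c' \o coord_inv c) }.

Section Manifold.
Variables (R : realType) (m : nat) (Z : manifold R m).
Local Notation E := 'rV[R]_m.
Local Notation dform := (dform R m).
Local Notation mvec := (mvec R m).

(* The tangent space at p is R^m, a tangent vector being given by its components
   in the preferred chart chart_at p.  Its components in any other chart are
   obtained with the Jacobian of the transition map. *)
Definition chart_at (p : Z) : atlas Z := projT1 (cid (dom_cover p)).

Definition to_chart (c : atlas Z) (p : Z) : E -> E :=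
  'd (coord c \o coord_inv (chart_at p)) (coord (chart_at p) p).

Definition of_chart (c : atlas Z) (p : Z) : E -> E :=
  'd (coord (chart_at p) \o coord_inv c) (coord c p).

(* Expressions of fields in the chart c, as functions on R^m that are meaningful
   on the image of c. *)
Definition vect_rep (c : atlas Z) (X : Z -> E) (x : E) : E :=
  to_chart c (coord_inv c x) (X (coord_inv c x)).

Definition form_rep (c : atlas Z) (a : Z -> dform) (x : E) : dform :=
  fun s => a (coord_inv c x) (map (of_chart c (coord_inv c x)) s).

Definition mvec_rep (c : atlas Z) (G : Z -> mvec) (x : E) : mvec :=
  fun b => G (coord_inv c x)
             (fun s => b (map (to_chart c (coord_inv c x)) s)).

Definition vect_field (X : Z -> E) : Prop :=
  forall c, smooth_on (coord c @` dom c) (vect_rep c X).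

Definition form_field_on (U : set Z) (k : nat) (a : Z -> dform) : Prop :=
  (forall p, U p -> is_form k (a p)) /\
  (forall c s, smooth_on (coord c @` (dom c `&` U))
                 (fun x => form_rep c a x s)).

Definition mvec_field_on (U : set Z) (k : nat) (G : Z -> mvec) : Prop :=
  (forall p, U p -> is_mvec k (G p)) /\
  (forall c b, is_form k b -> smooth_on (coord c @` (dom c `&` U))
                                (fun x => mvec_rep c G x b)).

Definition form_field := form_field_on setT.
Definition mvec_field := mvec_field_on setT.

(* (d a)(v_0,...,v_k) = \sum_i (-1)^i v_i (a(v_0,..,omit v_i,..,v_k)) for vectors
   v_i that are constant in the coordinates of chart_at p. *)
Definition ext_d (a : Z -> dform) (p : Z) : dform := fun s =>
  \sum_(i < size s) (-1) ^+ i *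
    'D_(s`_i) (fun x => form_rep (chart_at p) a x (take i s ++ drop i.+1 s) : R^o)
      (coord (chart_at p) p).

Definition contract_field (G : Z -> mvec) (a : Z -> dform) : Z -> dform :=
  fun p => contract (G p) (a p).

Definition lie_deriv (k : nat) (G : Z -> mvec) (a : Z -> dform) : Z -> dform :=
  ext_d (contract_field G a) - (-1) ^+ k *: contract_field G (ext_d a).

(* [X, Y] = D_X Y - D_Y X in the coordinates of chart_at p. *)
Definition lie_bracket (X Y : Z -> E) (p : Z) : E :=
  'D_(X p) (vect_rep (chart_at p) Y) (coord (chart_at p) p) -
  'D_(Y p) (vect_rep (chart_at p) X) (coord (chart_at p) p).

(* br k l is the bracket of k- with l-multivector fields.  In the exponents of
   -1, k - 1 is replaced by k.+1, which has the same parity also for k = 0. *)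
Record schouten_nijenhuis
    (br : nat -> nat -> (Z -> mvec) -> (Z -> mvec) -> (Z -> mvec)) : Prop := {
  sn_field : forall k l G G', mvec_field k G -> mvec_field l G' ->
    mvec_field (k + l).-1 (br k l G G') ;
  sn_linearl : forall k l (c : R) G1 G2 G',
    mvec_field k G1 -> mvec_field k G2 -> mvec_field l G' ->
    br k l (c *: G1 + G2) G' = c *: br k l G1 G' + br k l G2 G' ;
  sn_linearr : forall k l (c : R) G G1 G2,
    mvec_field k G -> mvec_field l G1 -> mvec_field l G2 ->
    br k l G (c *: G1 + G2) = c *: br k l G G1 + br k l G G2 ;
  sn_functions : forall f g, mvec_field 0 f -> mvec_field 0 g -> br 0 0 f g = 0 ;
  sn_vectors : forall X Y, vect_field X -> vect_field Y ->
    br 1 1 (fun p => decomposable [:: X p]) (fun p => decomposable [:: Y p]) =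
    (fun p => decomposable [:: lie_bracket X Y p]) ;
  sn_antisym : forall k l G G', mvec_field k G -> mvec_field l G' ->
    br k l G G' = - ((-1) ^+ (k.+1 * l.+1) *: br l k G' G) ;
  sn_leibniz : forall k l j G G' G'',
    mvec_field k G -> mvec_field l G' -> mvec_field j G'' ->
    br k (l + j) G (fun p => wedge l j (G' p) (G'' p)) =
    (fun p => wedge (k + l).-1 j (br k l G G' p) (G'' p)) +
    (-1) ^+ (k.+1 * l) *:
      (fun p => wedge l (k + j).-1 (G' p) (br k j G G'' p)) ;
  sn_jacobi : forall k l j G G' G'',
    mvec_field k G -> mvec_field l G' -> mvec_field j G'' ->
    (-1) ^+ (k.+1 * j.+1) *: br k (l + j).-1 G (br l j G' G'') +
    (-1) ^+ (l.+1 * k.+1) *: br l (j + k).-1 G' (br j k G'' G) +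
    (-1) ^+ (j.+1 * l.+1) *: br j (k + l).-1 G'' (br k l G G') = 0 }.

Section MultiDirac.
Variable n : nat.

Definition fiberL (r : nat) : set (mvec * dform) :=
  [set u | is_mvec r u.1 /\ is_form (n.+1 - r) u.2].

(* e = 1 gives the pairing << , >>_+ and e = -1 gives << , >>_-. *)
Definition pairing (e : R) (r s : nat) (u w : mvec * dform) : dform :=
  2^-1 *: (contract w.1 u.2 + (e * (-1) ^+ (r * s)) *: contract u.1 w.2).

Definition orthogonal_in (r s : nat) (V : set (mvec * dform)) :
    set (mvec * dform) :=
  [set w | fiberL s w /\ forall u, V u -> pairing (-1) r s u w = 0].

Definition sectionL_on (U : set Z) (r : nat) (x : Z -> mvec * dform) : Prop :=
  mvec_field_on U r (fst \o x) /\ form_field_on U (n.+1 - r) (snd \o x).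

Definition subbundle (r : nat) (V : Z -> set (mvec * dform)) : Prop :=
  forall p, exists (U : set Z) (N : nat) (e : 'I_N -> Z -> mvec * dform),
    [/\ open U, U p, forall i, sectionL_on U r (e i),
        forall q, U q -> forall c : 'I_N -> R,
          \sum_i c i *: e i q = 0 -> forall i, c i = 0
      & forall q, U q ->
          V q = [set \sum_i c i *: e i q | c in [set: 'I_N -> R]]].

(* D r p is the fiber at p of the subbundle D_r; only 1 <= r <= n matters. *)
Definition multi_dirac (D : nat -> Z -> set (mvec * dform)) : Prop :=
  (forall r, (1 <= r <= n)%N -> subbundle r (D r)) /\
  (forall r s, (1 <= r <= n)%N -> (1 <= s <= n)%N -> (r + s <= n.+1)%N ->
     forall p, orthogonal_in r s (D r p) = D s p).

Definition section_of (D : nat -> Z -> set (mvec * dform)) (r : nat)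
    (x : Z -> mvec * dform) : Prop :=
  sectionL_on setT r x /\ forall p, D r p (x p).

Variable br : nat -> nat -> (Z -> mvec) -> (Z -> mvec) -> (Z -> mvec).

Definition courant (r s : nat) (x y : Z -> mvec * dform) : Z -> mvec * dform :=
  if (r + s <= n.+1)%N then fun p =>
    (br r s (fst \o x) (fst \o y) p,
     (-1) ^+ (r.-1 * s) *: lie_deriv r (fst \o x) (snd \o y) p
     + (-1) ^+ s *: lie_deriv s (fst \o y) (snd \o x) p
     - (-1) ^+ s *: ext_d (fun q => pairing 1 r s (x q) (y q)) p)
  else 0.

Definition integrable_dirac (D : nat -> Z -> set (mvec * dform)) : Prop :=
  forall r s, (1 <= r <= n)%N -> (1 <= s <= n)%N ->
  forall x y, section_of D r x -> section_of D s y ->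
    if (r + s <= n.+1)%N then section_of D (r + s).-1 (courant r s x y)
    else courant r s x y = 0.

Definition graph_dirac (Omega : Z -> dform) (r : nat) (p : Z) :
    set (mvec * dform) :=
  [set u | exists2 G, is_mvec r G & u = (G, contract G (Omega p))].

End MultiDirac.

End Manifold.

(* Main.v *)
(* The contraction with the Schouten-Nijenhuis bracket is the graded commutator
   of the Lie derivative and the contraction:
     i_[G, G'] = (-1)^((r-1)s) L_G i_G' - i_G' L_G.
   Both sides satisfy the same Leibniz rule and the same antisymmetry, so the
   formula follows from the case of functions and vector fields, where it is
   Cartan's calculus; a bump function reduces a multivector field, at a given
   point, to wedge products of global vector fields.  Only one exterior
   derivative occurs in each term, so that every identity is checked at p in the
   preferred chart of p.  Applied to the sections (G, i_G Omega) and
   (G', i_G' Omega), the formula shows that their multi-Courant bracket is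
     ([G, G'], i_[G, G'] Omega - (-1)^r i_G' i_G d Omega),
   hence integrability means i_G' i_G d Omega = 0; vector fields suffice to
   recover d Omega = 0. *)
From mathcomp Require Import all_boot all_order all_algebra.
From mathcomp Require Import all_classical all_reals all_analysis.
From mathcomp Require Import ring lra zify.
Require Import Defs.

Set Implicit Arguments.
Unset Strict Implicit.
Unset Printing Implicit Defensive.

Import Order.TTheory GRing.Theory Num.Theory numFieldNormedType.Exports.
Local Open Scope classical_set_scope.
Local Open Scope ring_scope.

(** * Exterior algebra *)

(** The obstacle is that [br] is known only through axioms on global fields, so even its locality
    must be deduced: nothing says beforehand that fields agreeing near p have the same bracket with
    [G] at p. The Leibniz rule is the way out. If [h p = 0], then [h^2 G'] contributes nothing at p,
    neither to the bracket nor to the commutator, since both are of first order in [G']. Hence [G']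
    can be decomposed exactly on the whole of Z, the error of the cut-off being absorbed in such a
    term [h^2 G'], instead of approximately near p. The bracket of a vector field with a function is
    not an axiom either. It is forced by the axioms, but it becomes visible only against a vector
    field that is nonzero at p, whence the condition [0 < m]. On the algebraic side, the exterior
    powers are spaces of functionals with no basis given. One pair of dual bases, fixed for all
    points and charts, turns contractions, wedge products and their smoothness into finite sums. *)

Section RegularValued.
Variables (R : realType) (T : Type).
Implicit Types (f g : T -> R^o) (c : R) (t : T).

Lemma regDE f g t : (f + g) t = (f t : R) + g t :> R. Proof. by []. Qed.
Lemma regNE f t : (- f) t = - (f t : R) :> R. Proof. by []. Qed.
Lemma regZE c f t : (c *: f) t = c * f t :> R. Proof. by []. Qed.
Lemma reg0E t : (0 : T -> R^o) t = 0 :> R. Proof. by []. Qed.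
Lemma regsE (I : Type) (r : seq I) (P : pred I) (F : I -> T -> R^o) t :
  (\sum_(i <- r | P i) F i) t = \sum_(i <- r | P i) (F i t : R) :> R.
Proof. by rewrite fct_sumE. Qed.

End RegularValued.

Definition regE := (regDE, regNE, regZE, reg0E, regsE).

(* Equalities in [R^o] are turned into equalities in [R], which the arithmetic
   tactics understand. *)
Ltac toR := match goal with
  | R : realType |- @eq _ ?x ?y => change (@eq (Real.sort R) x y)
  end.

Section FormAlgebra.
Variables (R : realType) (m : nat).
Local Notation E := 'rV[R]_m.
Local Notation dform := (dform R m).
Local Notation mvec := (mvec R m).
Implicit Types (a b : dform) (G : mvec).

Lemma is_form0 k : is_form k (0 : dform).
Proof. by split=> // s1 s2 c u v; rewrite mulr0 addr0. Qed.

Lemma is_formP k (c : R) a b :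
  is_form k a -> is_form k b -> is_form k (c *: a + b).
Proof.
move=> [a0 al aa] [b0 bl ba]; split=> [s sk|s1 s2 d u v|s1 s2 s3 u].
- by toR; rewrite !regE a0 // b0 // mulr0 addr0.
- by toR; rewrite !regE al bl; ring.
- by toR; rewrite !regE aa ba mulr0 addr0.
Qed.

Lemma is_formD k a b : is_form k a -> is_form k b -> is_form k (a + b).
Proof. by move=> ak bk; rewrite -[a]scale1r; exact: is_formP. Qed.

Lemma is_formZ k c a : is_form k a -> is_form k (c *: a).
Proof. by move=> ak; rewrite -[_ *: _]addr0; apply: is_formP => //; exact: is_form0. Qed.

Lemma is_formB k a b : is_form k a -> is_form k b -> is_form k (a - b).
Proof. by move=> ak bk; rewrite -scaleN1r; apply: is_formD => //; exact: is_formZ. Qed.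

Lemma is_form_sum k (I : Type) (r : seq I) (P : pred I) (F : I -> dform) :
  (forall i, P i -> is_form k (F i)) -> is_form k (\sum_(i <- r | P i) F i).
Proof.
move=> Fk; elim/big_ind : _ => //; first exact: is_form0.
by move=> x y; exact: is_formD.
Qed.

Lemma is_form_size k a s : is_form k a -> size s != k -> a s = 0.
Proof. by case=> h _ _; exact: h. Qed.

Lemma is_form_prefix k a s : is_form (size s + k) a ->
  is_form k (fun t => a (s ++ t)).
Proof.
case=> a0 al aa; split=> [t tk|s1 s2 c u v|s1 s2 s3 u].
- by apply: a0; rewrite size_cat eqn_add2l.
- by rewrite !catA al.
- by rewrite catA aa.
Qed.

Lemma is_form_map k a (L : E -> E) :
  (forall (c : R) u v, L (c *: u + v) = c *: L u + L v) ->
  is_form k a -> is_form k (fun s => a (map L s)).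
Proof.
move=> Ll [a0 al aa]; split=> [s sk|s1 s2 c u v|s1 s2 s3 u].
- by apply: a0; rewrite size_map.
- by rewrite !map_cat /= Ll al.
- by rewrite !map_cat /= map_cat /= aa.
Qed.

Lemma form_swap k a s1 u v s2 : is_form k a ->
  a (s1 ++ u :: v :: s2) = - a (s1 ++ v :: u :: s2).
Proof.
case=> a0 al aa.
have := aa s1 [::] s2 (1 *: u + v).
rewrite /= al; have := al (rcons s1 u) s2 1 u v; have := al (rcons s1 v) s2 1 u v.
rewrite !cat_rcons => -> ->.
by have := aa s1 [::] s2 u; have := aa s1 [::] s2 v; rewrite /= => -> ->; lra.
Qed.

Lemma form_move k a s1 s2 u s3 : is_form k a ->
  a (s1 ++ s2 ++ u :: s3) = (-1) ^+ size s2 * a (s1 ++ u :: s2 ++ s3).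
Proof.
move=> ak; elim: s2 s1 => [|v s2 IH] s1; first by rewrite mul1r.
rewrite cat_cons -cat_rcons IH cat_rcons (form_swap _ _ _ _ ak) /= exprS.
ring.
Qed.

Lemma form_swap_cat k a p s t u : is_form k a ->
  a (p ++ s ++ t ++ u) = (-1) ^+ (size s * size t) * a (p ++ t ++ s ++ u).
Proof.
move=> ak; elim: t p => [|v t IH] p; first by rewrite muln0 mul1r.
rewrite cat_cons (form_move _ _ _ _ ak) -cat_rcons IH cat_rcons.
by rewrite mulrA -exprD -mulnS.
Qed.

Lemma mvecP k G (c : R) a b : is_mvec k G -> is_form k a -> is_form k b ->
  G (c *: a + b) = c * G a + G b.
Proof. by case=> h _; exact: h. Qed.

Lemma mvec0 k G : is_mvec k G -> G 0 = 0.
Proof.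
move=> Gk; have := mvecP 1 Gk (is_form0 k) (is_form0 k).
by rewrite scale1r addr0 => h; toR; move: h; lra.
Qed.

Lemma mvecZ k G (c : R) a : is_mvec k G -> is_form k a -> G (c *: a) = c * G a.
Proof.
move=> Gk ak; have := mvecP c Gk ak (is_form0 k).
by rewrite (mvec0 Gk) !addr0.
Qed.

Lemma mvec_sum k G (I : Type) (r : seq I) (c : I -> R) (F : I -> dform) :
  is_mvec k G -> (forall i, is_form k (F i)) ->
  G (\sum_(i <- r) c i *: F i) = \sum_(i <- r) c i * G (F i).
Proof.
move=> Gk Fk; elim: r => [|i r IH]; first by rewrite !big_nil (mvec0 Gk).
rewrite !big_cons (mvecP _ Gk) ?IH //.
by apply: is_form_sum => j _; exact: is_formZ.
Qed.

Lemma is_mvec0 k : is_mvec k (0 : mvec).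
Proof. by split=> // c a b _ _; rewrite mulr0 addr0. Qed.

Lemma is_mvecP k (c : R) G G' : is_mvec k G -> is_mvec k G' ->
  is_mvec k (c *: G + G').
Proof.
move=> [Gl G0] [Gl' G0']; split=> [d a b ak bk|a ak].
  by toR; rewrite !regE Gl // Gl' //; ring.
by toR; rewrite !regE G0 // G0' // mulr0 addr0.
Qed.

Lemma is_mvecD k G G' : is_mvec k G -> is_mvec k G' -> is_mvec k (G + G').
Proof. by move=> Gk Gk'; rewrite -[G]scale1r; exact: is_mvecP. Qed.

Lemma is_mvecZ k c G : is_mvec k G -> is_mvec k (c *: G).
Proof. by move=> Gk; rewrite -[_ *: _]addr0; apply: is_mvecP => //; exact: is_mvec0. Qed.

Lemma is_mvec_sum k (I : Type) (r : seq I) (P : pred I) (F : I -> mvec) :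
  (forall i, P i -> is_mvec k (F i)) -> is_mvec k (\sum_(i <- r | P i) F i).
Proof.
move=> Fk; elim/big_ind : _ => //; first exact: is_mvec0.
by move=> x y; exact: is_mvecD.
Qed.

Lemma decomposableE s a : is_form (size s) a -> decomposable s a = a s.
Proof. by move=> h; rewrite /decomposable; case: asboolP. Qed.

Lemma is_mvec_decomposable (s : seq E) : is_mvec (size s) (decomposable s).
Proof.
split=> [c a b ak bk|a ak]; last by rewrite /decomposable; case: asboolP.
by rewrite !decomposableE //; exact: is_formP.
Qed.

(** * Multilinear expansions and dual bases of the exterior powers *)

Definition multilinear a : Prop := forall s1 s2 (c : R) u v,
  a (s1 ++ (c *: u + v) :: s2) = c * a (s1 ++ u :: s2) + a (s1 ++ v :: s2).

Lemma is_form_multilinear k a : is_form k a -> multilinear a.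
Proof. by case. Qed.

(** Unlike [is_form_prefix], this prescribes no degree, which is why slots are expanded for
    multilinear functions rather than for forms. *)
Lemma multilinear_prefix a s : multilinear a -> multilinear (fun t => a (s ++ t)).
Proof. by move=> al s1 s2 c u v; rewrite !catA al. Qed.

Lemma multilinear_slot a s1 s2 u : multilinear a ->
  a (s1 ++ u :: s2) = \sum_j u 0 j * a (s1 ++ delta_mx 0 j :: s2).
Proof.
move=> al; pose f u := a (s1 ++ u :: s2).
have f0 : f 0 = 0.
  by have := al s1 s2 1 0 0; rewrite scale1r addr0 -/(f 0); lra.
rewrite {1}[u]row_sum_delta -[LHS]/(f _).
elim: (index_enum _) => [|j r IH]; first by rewrite !big_nil.
by rewrite !big_cons -IH /f al.
Qed.

(** Repetitions and permutations are kept: this family only serves to bound the size of dual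
    families, for which finiteness is enough. *)
Fixpoint basis_lists (r : nat) : seq (seq E) :=
  if r is r'.+1 then
    [seq delta_mx 0 j :: t | j <- enum 'I_m, t <- basis_lists r']
  else [:: [::]].

(** The coefficients depend on [s] alone and not on [a]; the matrix factorization in
    [dual_family_bound] relies on this order of quantifiers. *)
Lemma multilinear_expand r s : size s = r ->
  exists c : seq E -> R, forall a, multilinear a ->
    a s = \sum_(t <- basis_lists r) c t * a t.
Proof.
elim: r s => [|r IH] [|u s] //=.
  by move=> _; exists (fun=> 1) => a _; rewrite big_seq1 mul1r.
case=> /IH [c cE].
exists (fun t => (if t is w :: t' then
   (\sum_j u 0 j * (w == delta_mx 0 j)%:R) * c t' else 0)) => a al.
rewrite (multilinear_slot [::] s u al) /= big_allpairs_dep /= big_enum /=.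
apply: eq_bigr => j _; rewrite (cE (fun t => a (delta_mx 0 j :: t))).
  rewrite big_distrr /=; apply: eq_bigr => t _; rewrite mulrA; congr (_ * _ * _).
  rewrite (bigD1 j) //= eqxx mulr1 big1 ?addr0 // => i ij.
  case: eqP => [/matrixP /(_ 0 j)|]; last by rewrite mulr0.
  rewrite !mxE !eqxx /= eq_sym (negPf ij) => /eqP.
  by rewrite oner_eq0.
exact: (multilinear_prefix [:: delta_mx 0 j]).
Qed.

Definition dual_family r N (l : 'I_N -> seq E) (w : 'I_N -> dform) :=
  [/\ forall i, size (l i) = r, forall i, is_form r (w i)
    & forall i j, w i (l j) = (i == j)%:R].

(** Duality says that the identity matrix of size [N] is a product [W C] whose inner dimension is
    the number of basis lists; ranks give the bound. *)
Lemma dual_family_bound r N l w : @dual_family r N l w ->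
  (N <= size (basis_lists r))%N.
Proof.
move=> [lr wr wl].
have /choice [c cE] := fun j => multilinear_expand (lr j).
pose B := basis_lists r.
pose W := \matrix_(i < N, k < size B) w i (nth [::] B k).
pose C := \matrix_(k < size B, j < N) c j (nth [::] B k).
apply: (@mulmx1_min _ _ _ W C); apply/matrixP => i j; rewrite !mxE -wl.
rewrite (cE j _ (is_form_multilinear (wr i))) (big_nth [::]) big_mkord.
by apply: eq_bigr => k _; rewrite !mxE mulrC.
Qed.

(* A maximal dual family spans: a form vanishing on all the lists of the family
   could be used to enlarge it. *)
Lemma dual_forms_exist r :
  exists B : {N & (('I_N -> seq E) * ('I_N -> dform))%type},
    dual_family r (tagged B).1 (tagged B).2 /\
    forall a, is_form r a ->
      a = \sum_i a ((tagged B).1 i) *: (tagged B).2 i.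
Proof.
pose P N := `[< exists l w, @dual_family r N l w >].
have exP : exists N, P N.
  exists 0%N; apply/asboolP; exists (fun=> [::]), (fun=> 0).
  by split; case.
have bP N : P N -> (N <= size (basis_lists r))%N.
  by move=> /asboolP[l [w]]; exact: dual_family_bound.
case: (ex_maxnP exP bP) => N /asboolP[l [w lw]] Nmax.
exists (existT _ N (l, w)); split => //= a ar.
have [lr wr wl] := lw.
pose b := a - \sum_i a (l i) *: w i.
have br : is_form r b.
  by apply: is_formB => //; apply: is_form_sum => i _; exact: is_formZ.
have bl j : b (l j) = 0.
  rewrite /b; toR; rewrite !regE (bigD1 j) //= big1 => [|i ij].
    by rewrite addr0 regE wl eqxx mulr1 subrr.
  by rewrite regE wl (negPf ij) mulr0.
have [/eqP|/eqP b0] := eqVneq b 0; first by rewrite subr_eq0 => /eqP.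
exfalso; apply: b0; apply/funext => t; apply: contrapT => /eqP bt.
have tr : size t = r.
  by apply/eqP; apply: contraNT bt => /(is_form_size br) ->.
suff : P N.+1 by move/Nmax; rewrite ltnn.
apply/asboolP.
(* The new index [ord_max] receives [t] and [b] normalized at [t]. Each old [w j] is corrected by a
   multiple of [b], which kills its value at [t] and keeps its values at the old lists, where [b]
   vanishes. *)
exists (fun i => if unlift ord_max i is Some j then l j else t).
exists (fun i => if unlift ord_max i is Some j
                 then w j - (w j t / b t) *: b else (b t)^-1 *: b).
split=> [i|i|i j].
- by case: unliftP.
- by case: unliftP => [j|] _; [apply: is_formB => //|]; exact: is_formZ.
- have btV : (b t)^-1 * b t = 1 by rewrite mulVf.
  case: (unliftP ord_max i) => [i' ->|->]; case: (unliftP ord_max j) => [j' ->|->].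
  + by toR; rewrite (inj_eq lift_inj) -wl !regE bl mulr0 subr0.
  + toR; rewrite !regE -mulrA btV.
    by rewrite mulr1 subrr eq_sym (negPf (neq_lift _ _)).
  + by toR; rewrite (negPf (neq_lift _ _)) regE bl mulr0.
  + by toR; rewrite eqxx regE.
Qed.

(** Chosen once for each degree, independently of points and charts, so that the components of a
    field in this basis are functions whose smoothness can be discussed. *)
Definition dual_forms r := projT1 (cid (dual_forms_exist r)).
Definition nbasis r : nat := projT1 (dual_forms r).
Definition bvec r : 'I_(nbasis r) -> seq E := (tagged (dual_forms r)).1.
Definition bform r : 'I_(nbasis r) -> dform := (tagged (dual_forms r)).2.

Lemma size_bvec r i : size (@bvec r i) = r.
Proof. by case: (projT2 (cid (dual_forms_exist r))) => -[h _ _] _; exact: h. Qed.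

Lemma is_form_bform r i : is_form r (@bform r i).
Proof. by case: (projT2 (cid (dual_forms_exist r))) => -[_ h _] _; exact: h. Qed.

Lemma bform_bvec r i j : @bform r i (@bvec r j) = (i == j)%:R.
Proof. by case: (projT2 (cid (dual_forms_exist r))) => -[_ _ h] _; exact: h. Qed.

Lemma form_expand r a : is_form r a -> a = \sum_i a (@bvec r i) *: @bform r i.
Proof. by case: (projT2 (cid (dual_forms_exist r))) => _ h; exact: h. Qed.

Lemma mvec_expand r G a : is_mvec r G -> is_form r a ->
  G a = \sum_i G (@bform r i) * a (@bvec r i).
Proof.
move=> Gr ar; rewrite {1}(form_expand ar) (mvec_sum _ _ Gr).
  by apply: eq_bigr => i _; rewrite mulrC.
exact: is_form_bform.
Qed.

(** No relation between the degrees is needed. If [r + size s] differs from [k], the right side is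
    0; on the left the partial function is either not an [r]-form, where [G] is 0 by convention, or
    the zero form. *)
Lemma mvec_suffix r k G a s : is_mvec r G -> is_form k a ->
  G (fun t => a (t ++ s)) = \sum_i G (@bform r i) * a (@bvec r i ++ s).
Proof.
move=> Gr ak; have [rsk|rsk] := eqVneq (r + size s)%N k.
  by rewrite (mvec_expand Gr) //; apply: is_form_catr; rewrite rsk.
rewrite big1 => [|i _]; last first.
  by rewrite (is_form_size ak) ?mulr0 // size_cat size_bvec.
case: (Gr) => _ G0.
have [h|h] := pselect (is_form r (fun t => a (t ++ s))); last by rewrite G0.
suff -> : (fun t => a (t ++ s)) = 0 by rewrite (mvec0 Gr).
apply/funext => t; have [tr|tr] := eqVneq (size t) r.
  by rewrite (is_form_size ak) // size_cat tr.
by rewrite (is_form_size h).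
Qed.

Lemma mvec_prefix r k G a s : is_mvec r G -> is_form k a ->
  G (fun t => a (s ++ t)) = \sum_i G (@bform r i) * a (s ++ @bvec r i).
Proof.
move=> Gr ak; have [rsk|rsk] := eqVneq (size s + r)%N k.
  by rewrite (mvec_expand Gr) //; apply: is_form_prefix; rewrite rsk.
rewrite big1 => [|i _]; last first.
  by rewrite (is_form_size ak) ?mulr0 // size_cat size_bvec.
case: (Gr) => _ G0.
have [h|h] := pselect (is_form r (fun t => a (s ++ t))); last by rewrite G0.
suff -> : (fun t => a (s ++ t)) = 0 by rewrite (mvec0 Gr).
apply/funext => t; have [tr|tr] := eqVneq (size t) r.
  by rewrite (is_form_size ak) // size_cat tr.
by rewrite (is_form_size h).
Qed.

(** * Contraction and wedge product in the dual bases *)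

Lemma contractE r k G a s : is_mvec r G -> is_form k a ->
  contract G a s = \sum_i G (@bform r i) * a (@bvec r i ++ s).
Proof. exact: mvec_suffix. Qed.

Lemma contract_dec k a s t : is_form k a ->
  contract (decomposable s) a t = a (s ++ t).
Proof.
move=> ak; have [stk|stk] := eqVneq (size s + size t)%N k.
  by rewrite /contract decomposableE //; apply: is_form_catr; rewrite stk.
rewrite [RHS](is_form_size ak) ?size_cat //.
rewrite (contractE _ (is_mvec_decomposable s) ak) big1 // => i _.
by rewrite (is_form_size ak) ?mulr0 // size_cat size_bvec.
Qed.

(** The truncated [k - r] is harmless: for [k < r] the contraction is 0, a form of every degree. *)
Lemma is_form_contract r k G a : is_mvec r G -> is_form k a ->
  is_form (k - r) (contract G a).
Proof.
move=> Gr ak; have -> : contract G a =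
    \sum_i (G (@bform r i) : R) *: ((fun s => a (@bvec r i ++ s)) : dform).
  by apply/funext => s; toR; rewrite !regE (contractE _ Gr ak).
have [rk|kr] := leqP r k.
  apply: is_form_sum => i _; apply: is_formZ; apply: is_form_prefix.
  by rewrite size_bvec subnKC.
rewrite big1 => [|i _]; first exact: is_form0.
apply/funext => s; toR; rewrite regE (is_form_size ak) ?mulr0 //.
by rewrite size_cat size_bvec; apply/eqP => h; move: kr; rewrite -h ltnNge leq_addr.
Qed.

Lemma contract_small r k G a : is_mvec r G -> is_form k a -> (k < r)%N ->
  contract G a = 0.
Proof.
move=> Gr ak kr; apply/funext => s; rewrite (contractE _ Gr ak) big1 // => i _.
rewrite (is_form_size ak) ?mulr0 // size_cat size_bvec.
by apply/eqP => h; move: kr; rewrite -h ltnNge leq_addr.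
Qed.

Lemma contractP r k G (c : R) a b : is_mvec r G -> is_form k a -> is_form k b ->
  contract G (c *: a + b) = c *: contract G a + contract G b.
Proof.
move=> Gr ak bk; apply/funext => s.
toR; rewrite !regE (contractE _ Gr (is_formP c ak bk)).
rewrite (contractE _ Gr ak) (contractE _ Gr bk).
rewrite big_distrr /= -big_split /=; apply: eq_bigr => i _.
by rewrite !regE; ring.
Qed.

Lemma contractZ r k G (c : R) a : is_mvec r G -> is_form k a ->
  contract G (c *: a) = c *: contract G a.
Proof.
move=> Gr ak; have := contractP c Gr ak (is_form0 k); rewrite !addr0 => ->.
rewrite -[RHS]addr0; congr (_ + _); apply/funext => s.
exact: (mvec0 Gr).
Qed.

Lemma contractB r k G a b : is_mvec r G -> is_form k a -> is_form k b ->
  contract G (a - b) = contract G a - contract G b.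
Proof.
move=> Gr ak bk; rewrite addrC -scaleN1r (contractP _ Gr bk ak) scaleN1r.
exact: addrC.
Qed.

(** The sign is that of moving a block of [s] vectors past a block of [r] vectors in each term of
    the double sum. *)
Lemma contract_comm r s k G G' a : is_mvec r G -> is_mvec s G' -> is_form k a ->
  contract G (contract G' a) = (-1) ^+ (r * s) *: contract G' (contract G a).
Proof.
move=> Gr Gs ak; apply/funext => t.
toR; rewrite (contractE _ Gr (is_form_contract Gs ak)) regE.
rewrite (contractE _ Gs (is_form_contract Gr ak)).
under eq_bigr => i _ do rewrite (contractE _ Gs ak) big_distrr /=.
under [in RHS]eq_bigr => i _ do rewrite (contractE _ Gr ak) big_distrr /=.
rewrite exchange_big big_distrr /=; apply: eq_bigr => j _.
rewrite big_distrr /=; apply: eq_bigr => i _.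
by rewrite (form_swap_cat [::] _ _ _ ak) !size_bvec mulnC; ring.
Qed.

(** [wedge] feeds the first slots to [G] and the following ones to [G'], as successive contraction
    does. Later identities about wedge products are reduced to contractions through this one. *)
Lemma contract_wedge r s k G G' a : is_mvec r G -> is_mvec s G' -> is_form k a ->
  contract (wedge r s G G') a = contract G' (contract G a).
Proof.
move=> Gr Gs ak; apply/funext => t.
rewrite (contractE _ Gs (is_form_contract Gr ak)).
have e : \sum_i G' (bform i) * contract G a (@bvec s i ++ t) =
  \sum_i \sum_j G (@bform r i) * (G' (@bform s j) * a (bvec i ++ bvec j ++ t)).
  rewrite exchange_big; apply: eq_bigr => i _.
  by rewrite (contractE _ Gr ak) big_distrr /=; apply: eq_bigr => j _; rewrite mulrCA.
rewrite {}e; have [rk|rk] := eqVneq (r + s + size t)%N k; last first.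
  rewrite big1 => [|i _]; last first.
    rewrite big1 // => j _; rewrite (is_form_size ak) ?mulr0 //.
    by rewrite !size_cat !size_bvec addnA.
  (* In the wrong degree, the partial function passes the degree test of [wedge] only by being
     identically 0. *)
  rewrite /contract /wedge; case: asboolP => // h.
  have z u : a (u ++ t) = 0.
    have [ur|ur] := eqVneq (size u) (r + s)%N.
      by rewrite (is_form_size ak) // size_cat ur.
    exact: (is_form_size h).
  have -> : (fun v => G' (fun u => a ((v ++ u) ++ t))) = (0 : dform).
    apply/funext => v; rewrite -[RHS](mvec0 Gs); congr (G' _).
    by apply/funext => u; rewrite z.
  exact: (mvec0 Gr).
have ht : is_form (r + s) (fun u => a (u ++ t)) by apply: is_form_catr; rewrite rk.
rewrite /contract /wedge; case: asboolP => // _.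
under [X in G X]funext => u do
  rewrite (mvec_prefix u Gs ht).
have -> : (fun u => \sum_i G' (bform i) * a ((u ++ @bvec s i) ++ t)) =
   \sum_i (G' (@bform s i) : R) *: ((fun u => a (u ++ bvec i ++ t)) : dform).
  by apply/funext => u; toR; rewrite regE; apply: eq_bigr => i _; rewrite regE catA.
rewrite (mvec_sum _ _ Gr) => [|i]; last first.
  by apply: is_form_catr; rewrite size_cat size_bvec addnA rk.
rewrite exchange_big; apply: eq_bigr => i _.
rewrite (mvec_suffix _ Gr ak) big_distrr /=; apply: eq_bigr => j _.
by rewrite mulrCA.
Qed.

Lemma wedge_expand r s G G' a : is_mvec r G -> is_mvec s G' ->
  is_form (r + s) a -> wedge r s G G' a =
    \sum_i \sum_j G (@bform r i) * (G' (@bform s j) * a (bvec i ++ bvec j)).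
Proof.
move=> Gr Gs ak.
(* Evaluation at the empty list recovers a functional from its contraction. *)
have e H (b : dform) : contract H b [::] = H b.
  by rewrite /contract; congr (H _); apply/funext => t; rewrite cats0.
rewrite -[LHS]e (contract_wedge Gr Gs ak) e (mvec_expand Gs).
  rewrite exchange_big; apply: eq_bigr => j _; rewrite (contractE _ Gr ak).
  by rewrite big_distrr /=; apply: eq_bigr => i _; rewrite mulrCA.
by have := is_form_contract Gr ak; rewrite addKn.
Qed.

Lemma is_mvec_wedge r s G G' : is_mvec r G -> is_mvec s G' ->
  is_mvec (r + s) (wedge r s G G').
Proof.
move=> Gr Gs; split=> [c a b ak bk|a ak]; last by rewrite /wedge; case: asboolP.
rewrite !(wedge_expand Gr Gs) //; last exact: is_formP.
rewrite big_distrr -big_split /=; apply: eq_bigr => i _.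
rewrite big_distrr -big_split /=; apply: eq_bigr => j _.
by rewrite !regE; ring.
Qed.

Lemma wedge_dec (s t : seq E) : wedge (size s) (size t) (decomposable s) (decomposable t) =
  decomposable (s ++ t).
Proof.
apply/funext => a; rewrite /wedge {3}/decomposable size_cat; case: asboolP => // ak.
have h : (fun u => decomposable t (fun v => a (u ++ v))) = fun u => a (u ++ t).
  apply/funext => u; have [us|us] := eqVneq (size u) (size s).
    by rewrite decomposableE //; apply: is_form_prefix; rewrite us.
  rewrite (mvec_prefix u (is_mvec_decomposable t) ak) (is_form_size ak).
    rewrite big1 // => i _; rewrite (is_form_size ak) ?mulr0 //.
    by rewrite size_cat size_bvec eqn_add2r.
  by rewrite size_cat eqn_add2r.
by rewrite h decomposableE //; apply: is_form_catr.
Qed.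

End FormAlgebra.

(** * Smooth maps on open sets of R^m *)

Section NearDifferentiable.
Variables (R : realType) (V W : normedModType R).

(** Chart maps are total functions that mean something only on the chart, so identities between them
    hold only near a point; this transfers differentials along such identities. *)
Lemma near_eq_diff (f g : V -> W) (x : V) : (\near x, f x = g x) ->
  differentiable f x -> differentiable g x /\ 'd g x = 'd f x :> (V -> W).
Proof.
move=> fg /diff_locallyP[dfc dfx].
have gx : g \o shift x = cst (g x) + 'd f x +o_ 0 id.
  apply/eqaddoP => _/posnumP[e].
  have /eqaddoP/(_ _ (gt0 e)) := dfx; rewrite -(nbhs_singleton fg).
  have fg0 : \forall y \near (0 : V), f (y + x) = g (y + x).
    by move: fg; rewrite (near_shift 0) subr0.
  by apply: filterS2 fg0 => y; rewrite !fctE /= => ->.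
have dg := diff_unique dfc gx.
by split=> //; apply/diff_locallyP; rewrite dg.
Qed.

End NearDifferentiable.

Section Smooth.
Variables (R : realType) (m : nat).
Local Notation E := 'rV[R]_m.

(** Recursion on the order, in place of the lists of directions in [smooth_on], suits inductions by
    the product and chain rules. Order 0 already asks for differentiability. *)
Fixpoint Ck (V : normedModType R) (k : nat) (U : set E) (f : E -> V) : Prop :=
  (forall x, U x -> differentiable f x) /\
  if k is k'.+1 then forall v, Ck k' U ('D_v f) else True.

Section Generic.
Variable V : normedModType R.
Implicit Types (f g : E -> V) (U : set E).

Lemma Ck_diff k U f x : Ck k U f -> U x -> differentiable f x.
Proof. by case: k => [|k] [h _]; exact: h. Qed.

Lemma Ck_pred k U f : Ck k.+1 U f -> Ck k U f.
Proof.
elim: k f => [|k IH] f [df h]; split=> // v.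
exact/IH/h.
Qed.

Lemma smooth_derive U f v : smooth_on U f -> smooth_on U ('D_v f).
Proof.
move=> fU vs x Ux; have := fU (rcons vs v) x Ux; rewrite foldr_rcons => h; exact: h.
Qed.

Lemma smooth_onP U f : smooth_on U f <-> forall k, Ck k U f.
Proof.
split=> [fU k|fU vs].
  elim: k f fU => [|k IH] f fU; split; try exact: (fU [::]); first by [].
  by move=> v; exact/IH/smooth_derive.
(* [foldr] differentiates along the last direction of the list first, hence the induction from the
   right. *)
elim/last_ind: vs f fU => [|vs v IH] f fU x Ux; first exact: (Ck_diff (fU 0%N)).
rewrite foldr_rcons; apply: (IH ('D_v f)) => // k.
by case: (fU k.+1) => _ h; exact: h.
Qed.

Lemma smooth_diff U f x : smooth_on U f -> U x -> differentiable f x.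
Proof. by move=> fU Ux; exact: (fU [::]). Qed.

Lemma open_near_eq U f g x : open U -> (forall y, U y -> f y = g y) -> U x ->
  \near x, f x = g x.
Proof.
by move=> Uo fg Ux; apply: filterS (open_nbhs_nbhs (conj Uo Ux)) => y; exact: fg.
Qed.

Lemma Ck_eq k U f g : open U -> (forall x, U x -> f x = g x) ->
  Ck k U f -> Ck k U g.
Proof.
move=> Uo; elim: k f g => [|k IH] f g fg [df h]; split=> //.
- by move=> x Ux; case: (near_eq_diff (open_near_eq Uo fg Ux) (df _ Ux)).
- by move=> x Ux; case: (near_eq_diff (open_near_eq Uo fg Ux) (df _ Ux)).
- move=> v; apply: IH (h v) => x Ux; apply: near_eq_derive.
  exact: (open_near_eq Uo fg Ux).
Qed.

Lemma smooth_eq U f g : open U -> (forall x, U x -> f x = g x) ->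
  smooth_on U f -> smooth_on U g.
Proof.
by move=> Uo fg /smooth_onP fU; apply/smooth_onP => k; exact: Ck_eq fg _.
Qed.

Lemma smooth_sub U U' f : U' `<=` U -> smooth_on U f -> smooth_on U' f.
Proof. by move=> UU' fU vs x /UU'; exact: fU. Qed.

Lemma smooth_local U f : (forall x, U x -> exists2 U', U' x & smooth_on U' f) ->
  smooth_on U f.
Proof. by move=> h vs x /h[U' Ux]; exact. Qed.

Lemma Ck_cst k U (c : V) : Ck k U (fun=> c).
Proof.
elim: k c => [|k IH] c; split=> //.
have -> : (fun=> c) = cst c :> (E -> V) by [].
by move=> v; have -> : 'D_v (cst c) = fun=> 0 by apply/funext => x; rewrite derive_cst.
Qed.

Lemma smooth_cst U (c : V) : smooth_on U (fun=> c).
Proof. by apply/smooth_onP => k; exact: Ck_cst. Qed.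

Lemma Ck_add k U f g : open U -> Ck k U f -> Ck k U g ->
  Ck k U (fun x => f x + g x).
Proof.
move=> Uo; elim: k f g => [|k IH] f g [df hf] [dg hg]; split=> //.
- by move=> x Ux; apply: differentiableD; [exact: df|exact: dg].
- by move=> x Ux; apply: differentiableD; [exact: df|exact: dg].
- move=> v; apply: Ck_eq (IH _ _ (hf v) (hg v)) => // x Ux.
  by rewrite -deriveD //; apply: diff_derivable; [exact: df|exact: dg].
Qed.

Lemma Ck_scale k U (c : R) f : open U -> Ck k U f -> Ck k U (fun x => c *: f x).
Proof.
move=> Uo; elim: k f => [|k IH] f [df hf]; split=> //.
- by move=> x Ux; apply: differentiableZ; exact: df.
- by move=> x Ux; apply: differentiableZ; exact: df.
- move=> v; apply: Ck_eq (IH _ (hf v)) => // x Ux.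
  by rewrite -deriveZ //; apply: diff_derivable; exact: df.
Qed.

Lemma smooth_sum U (I : Type) (r : seq I) (F : I -> E -> V) : open U ->
  (forall i, smooth_on U (F i)) -> smooth_on U (fun x => \sum_(i <- r) F i x).
Proof.
move=> Uo FU; apply/smooth_onP => k; elim: r => [|i r IH].
  by under eq_fun do rewrite big_nil; exact: Ck_cst.
under eq_fun do rewrite big_cons; apply: Ck_add => //.
by move: (FU i) => /smooth_onP h; exact: h.
Qed.

Lemma Ck_scalel k U (f : E -> R^o) (w : V) : open U -> Ck k U f ->
  Ck k U (fun x => f x *: w).
Proof.
move=> Uo; elim: k f => [|k IH] f [df hf]; split=> //.
- by move=> x Ux; apply: differentiableZl; exact: df.
- by move=> x Ux; apply: differentiableZl; exact: df.
- move=> v; apply: Ck_eq (IH _ (hf v)) => // x Ux.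
  rewrite !deriveE; [|exact: differentiableZl (df _ _)|exact: df].
  by rewrite diffZl //; exact: df.
Qed.

End Generic.

Lemma Ck_mul k U (f g : E -> R^o) : open U -> Ck k U f -> Ck k U g ->
  Ck k U ((fun x => f x * g x) : E -> R^o).
Proof.
move=> Uo; elim: k f g => [|k IH] f g.
  move=> [df _] [dg _]; split=> // x Ux; apply: differentiableM.
    exact: df.
  exact: dg.
move=> kf kg; split=> [x Ux|v].
  by apply: differentiableM; [exact: (Ck_diff kf)|exact: (Ck_diff kg)].
have [df hf] := kf; have [dg hg] := kg.
apply: (@Ck_eq _ _ _ (fun x => (f x * 'D_v g x) + (g x * 'D_v f x) : R^o)) => //.
  move=> x Ux; rewrite -[LHS]deriveM //; apply: diff_derivable.
    exact: df.
  exact: dg.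
by apply: Ck_add => //; apply: IH; by [exact: Ck_pred|exact: hf|exact: hg].
Qed.

Lemma smooth_mul U (f g : E -> R^o) : open U -> smooth_on U f -> smooth_on U g ->
  smooth_on U ((fun x => f x * g x) : E -> R^o).
Proof.
by move=> Uo /smooth_onP fU /smooth_onP gU; apply/smooth_onP => k; exact: Ck_mul.
Qed.

Lemma smooth_add (V : normedModType R) U (f g : E -> V) : open U ->
  smooth_on U f -> smooth_on U g -> smooth_on U (fun x => f x + g x).
Proof.
by move=> Uo /smooth_onP fU /smooth_onP gU; apply/smooth_onP => k; exact: Ck_add.
Qed.

Lemma smooth_scale (V : normedModType R) U c (f : E -> V) : open U ->
  smooth_on U f -> smooth_on U (fun x => c *: f x).
Proof. by move=> Uo /smooth_onP fU; apply/smooth_onP => k; exact: Ck_scale. Qed.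

Lemma differentiable_entry (f : E -> E) x j : differentiable f x ->
  differentiable (fun y => f y 0 j : R^o) x.
Proof.
move=> df; have -> : (fun y => f y 0 j : R^o) = (fun N : E => N 0 j : R^o) \o f by [].
by apply: differentiable_comp => //; exact: differentiable_coord.
Qed.

Lemma derive_entry (f : E -> E) x v j : differentiable f x ->
  'D_v (fun y => f y 0 j : R^o) x = 'D_v f x 0 j.
Proof. by move=> df; rewrite derive_mx ?mxE //; exact: diff_derivable. Qed.

Lemma Ck_entry k U (f : E -> E) j : open U -> Ck k U f ->
  Ck k U (fun x => f x 0 j : R^o).
Proof.
move=> Uo; elim: k f => [|k IH] f [df hf]; split=> //.
- by move=> x /df; exact: differentiable_entry.
- by move=> x /df; exact: differentiable_entry.
- move=> v; apply: Ck_eq (IH _ (hf v)) => // x Ux.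
  by rewrite derive_entry //; exact: df.
Qed.

Lemma smooth_entry U (f : E -> E) j : open U -> smooth_on U f ->
  smooth_on U (fun x => f x 0 j : R^o).
Proof. by move=> Uo /smooth_onP fU; apply/smooth_onP => k; exact: Ck_entry. Qed.

Lemma Ck_entries k U (f : E -> E) : open U ->
  (forall j, Ck k U (fun x => f x 0 j : R^o)) -> Ck k U f.
Proof.
move=> Uo fU.
have -> : f = fun x => \sum_j (f x 0 j) *: delta_mx 0 j.
  by apply/funext => x; rewrite {1}[f x]row_sum_delta.
elim: (index_enum _) => [|j r IH].
  by under eq_fun do rewrite big_nil; exact: Ck_cst.
under eq_fun do rewrite big_cons; apply: Ck_add => //.
exact: (Ck_scalel (f := fun x => f x 0 j)).
Qed.

Lemma smooth_entries U (f : E -> E) : open U ->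
  (forall j, smooth_on U (fun x => f x 0 j : R^o)) -> smooth_on U f.
Proof.
move=> Uo fU; apply/smooth_onP => k; apply: Ck_entries => // j.
by have /smooth_onP := fU j.
Qed.

Lemma smooth_scalev U (f : E -> R^o) (X : E -> E) : open U ->
  smooth_on U f -> smooth_on U X -> smooth_on U (fun x => (f x : R) *: X x).
Proof.
move=> Uo fU XU; apply: smooth_entries => // j.
under eq_fun do rewrite mxE.
by apply: smooth_mul => //; exact: smooth_entry.
Qed.

Lemma smooth_id U : open U -> smooth_on U (@id E).
Proof.
move=> Uo; have did (x : E) : differentiable id x by exact: ex_diff.
apply/smooth_onP => -[|k]; split=> // v.
have -> : 'D_v id = (fun=> v : E) by apply/funext => x; rewrite derive_id.
exact: Ck_cst.
Qed.

Lemma derive_comp (V : normedModType R) (f : E -> E) (g : E -> V) x v :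
  differentiable f x -> differentiable g (f x) ->
  'D_v (g \o f) x = 'D_('D_v f x) g (f x).
Proof.
move=> df dg; rewrite !deriveE //; last exact: differentiable_comp.
by rewrite diff_comp.
Qed.

Lemma derive_sum_entries (V : normedModType R) (g : E -> V) x v :
  differentiable g x -> 'D_v g x = \sum_j v 0 j *: 'D_(delta_mx 0 j) g x.
Proof.
move=> dg; under eq_bigr do rewrite deriveE //.
rewrite deriveE // {1}[v]row_sum_delta linear_sum.
by apply: eq_bigr => j _; rewrite linearZ.
Qed.

(** The chain rule is written with partial derivatives of [g] along fixed basis vectors: the
    direction ['D_v f x] moves with [x], whereas each partial derivative composed with [f] falls
    under the induction hypothesis. *)
Lemma Ck_comp k U W (f : E -> E) (g : E -> R^o) : open U -> open W ->
  (forall x, U x -> W (f x)) -> Ck k U f -> Ck k W g -> Ck k U (g \o f).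
Proof.
move=> Uo Wo fUW; elim: k g => [|k IH] g kf kg.
  split=> // x Ux; apply: differentiable_comp; first exact: (Ck_diff kf).
  by apply: (Ck_diff kg); exact: fUW.
have [df hf] := kf; have [dg hg] := kg; split=> [x Ux|v].
  by apply: differentiable_comp; [exact: df|apply: dg; exact: fUW].
apply: (@Ck_eq _ _ _ (fun x => \sum_j ('D_v f x 0 j *
   ('D_(delta_mx 0 j) g \o f) x : R^o))) => //.
  move=> x Ux; have dfx := df x Ux; have dgx := dg _ (fUW x Ux).
  by rewrite [RHS](derive_comp _ dfx dgx) [RHS]derive_sum_entries.
elim: (index_enum _) => [|j r IHr].
  by under eq_fun do rewrite big_nil; exact: Ck_cst.
under eq_fun do rewrite big_cons; apply: Ck_add => //.
apply: Ck_mul => //; first by apply: Ck_entry => //; exact: hf.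
by apply: IH; by [exact: Ck_pred|exact: hg].
Qed.

Lemma smooth_comp U W (f : E -> E) (g : E -> R^o) : open U -> open W ->
  (forall x, U x -> W (f x)) -> smooth_on U f -> smooth_on W g ->
  smooth_on U (g \o f).
Proof.
move=> Uo Wo fUW /smooth_onP fU /smooth_onP gW; apply/smooth_onP => k.
exact: (Ck_comp _ Wo).
Qed.

Lemma smooth_compv U W (f g : E -> E) : open U -> open W ->
  (forall x, U x -> W (f x)) -> smooth_on U f -> smooth_on W g ->
  smooth_on U (g \o f).
Proof.
move=> Uo Wo fUW fU gW; apply: smooth_entries => // j.
apply: (@smooth_comp U W f (fun y => g y 0 j)) => //.
exact: smooth_entry.
Qed.

(** [A] is generalized in the induction: once the first slot is expanded, its basis vector is
    absorbed into [A]. *)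
Lemma smooth_multilinear U (I : Type) (A : E -> dform R m) (u : I -> E -> E)
    (r : seq I) s : open U ->
  (forall x, multilinear (A x)) -> (forall t, smooth_on U (fun x => A x t)) ->
  (forall i, smooth_on U (u i)) ->
  smooth_on U (fun x => A x ([seq u i x | i <- r] ++ s)).
Proof.
move=> Uo Al AU uU; elim: r A Al AU => [|i r IH] A Al AU; first exact: AU.
have -> : (fun x => A x ([seq u i x | i <- i :: r] ++ s)) =
    fun x => \sum_j (u i x 0 j * A x (delta_mx 0 j :: [seq u i x | i <- r] ++ s) : R^o).
  by apply/funext => x; rewrite /= (multilinear_slot [::] _ _ (Al x)).
apply: smooth_sum => // j; apply: smooth_mul => //; first exact: smooth_entry.
apply: (IH (fun x t => A x (delta_mx 0 j :: t))) => [x|t]; last exact: AU.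
exact: (multilinear_prefix [:: delta_mx 0 j]).
Qed.

End Smooth.

(** * Bump functions *)

Section FlatFunction.
Variable R : realType.

(** The powers of [u^-1] make the family stable under differentiation, so that the smoothness of
    exp(-1/u), the case [n = 0], follows by induction for all [n] at once. *)
Definition flat (n : nat) (u : R) : R^o :=
  if 0 < u then u^-1 ^+ n * expR (- u^-1) else 0.

(** A single term of the exponential series at [u^-1], that of degree [n.+2], beats [u^-1 ^+ n] with
    a factor [u ^+ 2] to spare, enough for a zero derivative at 0. *)
Lemma flat_bound n (u : R) : `|flat n u| <= n.+2`!%:R * u ^+ 2.
Proof.
rewrite /flat; case: ltP => [u0|_]; last first.
  by rewrite normr0 mulr_ge0 // sqr_ge0.
have uV0 : 0 < u^-1 by rewrite invr_gt0.
have := expR_ge1Dxn n.+1 (ltW uV0).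
set F : R := n.+2`!%:R; have F0 : 0 < F by rewrite ltr0n fact_gt0.
move=> h; have le1 : u^-1 ^+ n.+2 / F <= expR u^-1.
  by apply: le_trans h; rewrite lerDr.
rewrite ger0_norm; last by rewrite mulr_ge0 // ?expR_ge0 // exprn_ge0 // ltW.
rewrite expRN ler_pdivrMr ?expR_gt0 //.
apply: le_trans (_ : F * u ^+ 2 * (u^-1 ^+ n.+2 / F) <= _); last first.
  by rewrite ler_wpM2l // mulr_ge0 ?sqr_ge0 // ltW.
rewrite le_eqVlt; apply/orP; left; apply/eqP.
rewrite -(addn2 n) exprD.
have -> : F * u ^+ 2 * (u^-1 ^+ n * u^-1 ^+ 2 / F) =
    u^-1 ^+ n * ((u / u) ^+ 2) * (F / F) by ring.
by rewrite !divff ?expr1n ?mulr1 // lt0r_neq0.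
Qed.

Lemma is_derive_flat n (u : R) :
  is_derive u 1 (flat n : R -> R^o) (flat n.+2 u - n%:R * flat n.+1 u).
Proof.
have [u0|u0|->] := ltgtP u 0.
- rewrite /flat !ltNge !(ltW u0) /= mulr0 subr0.
  apply: (near_eq_is_derive (f := cst 0)).
  near=> v; have v0 : v < 0 by near: v; exact: lt_nbhsl.
  by rewrite ltNge (ltW v0).
- rewrite /flat u0.
  apply: (near_eq_is_derive
    (f := ((fun v => v^-1) ^+ n) * (expR \o (- (fun v => v^-1))))).
    near=> v; have v0 : 0 < v by near: v; exact: lt_nbhsr.
    by rewrite v0 !fctE.
  have un0 : u != 0 by rewrite lt0r_neq0.
  have dV : is_derive u 1 (fun v : R => v^-1) (- u ^- 2 *: 1).
    exact: (is_deriveV (f := id)).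
  have dE : is_derive u 1 (expR \o (- (fun v : R => v^-1))) (expR (- u^-1) * - (- u ^- 2 *: 1)).
    exact: is_derive1_comp.
  apply: is_derive_eq; rewrite !fctE /GRing.scale /= mulr1 -exprVn.
  by case: n => [|n] /=; rewrite ?exprS; ring.
- rewrite /flat ltxx mulr0 subr0; set f := (X in is_derive _ _ X _).
  have f0 : (fun h : R => h^-1 *: (f (h *: 1 + 0) - f 0)) @ 0^' --> (0 : R^o).
    apply/cvgrPdist_le => /= e e0.
    have F0 : 0 < n.+2`!%:R :> R by rewrite ltr0n fact_gt0.
    near=> h; rewrite sub0r normrN.
    rewrite [f 0]/f ltxx subr0 addr0 -[h *: 1]/(h * 1) mulr1 normrM normfV.
    have h0 : h != 0 by near: h; exact: nbhs_dnbhs_neq.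
    have hlt : `|h| <= e / n.+2`!%:R by near: h; apply: dnbhs0_le; rewrite divr_gt0.
    rewrite ler_pdivrMl ?normr_gt0 //; apply: le_trans (flat_bound n h) _.
    rewrite -real_normK ?num_real // expr2 mulrCA ler_wpM2l //.
    by rewrite mulrC -ler_pdivlMr.
  apply: DeriveDef; last exact: cvg_lim f0.
  by apply/cvg_ex; exists 0.
Unshelve. all: by end_near. Qed.

End FlatFunction.

Section Bump.
Variables (R : realType) (m : nat).
Local Notation E := 'rV[R]_m.

Lemma differentiable_flat n (u : R) : differentiable (flat n : R -> R^o) u.
Proof. by apply/derivable1_diffP; case: (is_derive_flat n u). Qed.

Lemma Ck_flat k n (q : E -> R^o) : (forall k, Ck k setT q) ->
  Ck k setT (flat n \o q).
Proof.
move=> qC; have dq x : differentiable q x by exact: (Ck_diff (qC 0%N)).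
have dqn n' x : differentiable (flat n' \o q) x.
  by apply: differentiable_comp => //; exact: differentiable_flat.
elim: k n => [|k IH] n; split=> // v.
have -> : 'D_v (flat n \o q) =
   fun x => ((flat n.+2 \o q) x + - n%:R *: (flat n.+1 \o q) x) * 'D_v q x.
  apply/funext => x; rewrite deriveE // diff_comp //; last exact: differentiable_flat.
  have df := differentiable_flat n (q x).
  have [_ h] := is_derive_flat n (q x).
  have e (w : R) : 'd (flat n : R -> R^o) (q x) w =
      w * (flat n.+2 (q x) - n%:R * flat n.+1 (q x)).
    rewrite -h (deriveE _ df) -[RHS]/(w *: _) -linearZ.
    by congr ('d _ _ _); rewrite -[RHS]/(w * 1) mulr1.
  rewrite /= e (deriveE v (dq x)) -[LHS]/(_ * _) mulrC.
  by congr (_ * _); rewrite -[_ *: _]/(_ * _) mulNr.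
have Uo : open (setT : set E) by exact: openT.
apply: Ck_mul => //; first by apply: Ck_add => //; apply: Ck_scale.
by case: (qC k.+1) => _ h; exact: h.
Qed.

(** [flat 0] is applied to the polynomial [e^2 - |x - a|^2], positive only in a Euclidean ball. That
    ball lies in the cube [K] of half-side [e], compact as a product of segments; taking [e] to be
    half the radius [d] keeps [K] inside the open ball of the norm of E. *)
Lemma bump_function (U : set E) (a : E) : open U -> U a ->
  exists chi : E -> R^o, [/\ smooth_on setT chi, chi a = 1 &
    exists K, [/\ compact K, K `<=` U & forall x, ~ K x -> chi x = 0]].
Proof.
move=> Uo Ua; have := open_nbhs_nbhs (conj Uo Ua).
move=> /nbhs_ballP[d /= d0 dU]; pose e := d / 2.
have e0 : 0 < e by rewrite divr_gt0.
have ed : e < d by rewrite ltr_pdivrMr // ltr_pMr // ltr1n.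
pose q x : R^o := e ^+ 2 + - 1 *: \sum_j ((x - a) 0 j * (x - a) 0 j : R^o).
have To : open (setT : set E) by exact: openT.
have qC k : Ck k setT q.
  apply: Ck_add => //; first exact: Ck_cst.
  apply: Ck_scale => //.
  suff /smooth_onP h : smooth_on setT (fun x : E => \sum_j ((x - a) 0 j * (x - a) 0 j : R^o)).
    exact: h.
  apply: smooth_sum => // j.
  have hj : smooth_on setT (fun x => (x - a) 0 j : R^o).
    apply: smooth_entry => //; apply: smooth_add => //; first exact: smooth_id.
    exact: smooth_cst.
  exact: smooth_mul.
have qa : q a = e ^+ 2.
  by rewrite /q big1 ?scaler0 ?addr0 // => j _; rewrite subrr mxE mul0r.
have fa0 : flat 0 (q a) != 0.
  by rewrite qa /flat exprn_gt0 // expr0 mul1r gt_eqF // expR_gt0.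
exists (fun x => (flat 0 (q a))^-1 *: (flat 0 \o q) x); split.
- by apply: smooth_scale => //; apply/smooth_onP => k; exact: Ck_flat.
- by rewrite /= -[_ *: _]/(_ * _) mulVf.
pose K := [set x : E | forall j, `[a 0 j - e, a 0 j + e]%classic (x 0 j)].
exists K; split.
- have cK := rV_compact (fun j : 'I_m => @segment_compact R (a 0 j - e) (a 0 j + e)).
  exact: cK.
- move=> x Kx; apply: dU; split=> // i j; rewrite (ord1 i) /ball /= /ball_.
  have := Kx j; rewrite /= in_itv /= => /andP[h1 h2].
  by rewrite (le_lt_trans _ ed) // ler_norml; apply/andP; split; lra.
- move=> x Kx; suff qx0 : q x <= 0.
    by rewrite [X in _ *: X](_ : _ = 0) ?scaler0 // /= /flat ltNge qx0.
  rewrite leNgt; apply/negP => qx; apply: Kx => j.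
  have sq0 i : 0 <= (x - a) 0 i * (x - a) 0 i by rewrite -expr2 sqr_ge0.
  have : (x - a) 0 j * (x - a) 0 j < e ^+ 2.
    move: qx; rewrite /q scaleN1r subr_gt0; apply: le_lt_trans.
    by rewrite (bigD1 j) //= lerDl sumr_ge0.
  rewrite -expr2 -[X in X < _]real_normK ?num_real // ltr_pXn2r ?nnegrE // ?(ltW e0) //.
  rewrite !mxE ltr_norml => /andP[h1 h2].
  by rewrite /= in_itv /=; apply/andP; split; lra.
Qed.

End Bump.

(** * Charts *)

Section Charts.
Variables (R : realType) (m : nat) (Z : manifold R m).
Local Notation E := 'rV[R]_m.
Local Notation dform := (dform R m).
Local Notation mvec := (mvec R m).
Implicit Types (c : atlas Z) (p q : Z) (U : set Z).

Definition chart_img c U : set E := coord c @` (dom c `&` U).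

Lemma chart_imgP c U x : chart_img c U x ->
  [/\ dom c (coord_inv c x), U (coord_inv c x) & coord c (coord_inv c x) = x].
Proof. by move=> [p [cp Up] <-]; rewrite coordK. Qed.

Lemma chart_img_coord c U p : dom c p -> U p -> chart_img c U (coord c p).
Proof. by move=> cp Up; exists p. Qed.

Lemma chart_imgT c : chart_img c setT = coord c @` dom c.
Proof. by rewrite /chart_img setIT. Qed.

Lemma chart_imgS c U x : chart_img c U x -> chart_img c setT x.
Proof. by move=> [p [cp Up] <-]; exact: chart_img_coord. Qed.

Lemma open_chart_img c U : open U -> open (chart_img c U).
Proof.
move=> Uo; rewrite openE => x [p [cp Up] xE]; rewrite /interior.
have cx : (coord c @` dom c) x by exists p.
have n1 := open_nbhs_nbhs (conj (coord_open (c := c)) cx).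
have pE : coord_inv c x = p by rewrite -xE coordK.
have n2 : nbhs (coord_inv c x) U by rewrite pE; exact: open_nbhs_nbhs.
have n3 := coord_inv_continuous cx n2.
apply: filterS2 n1 n3 => y [q cq <-]; rewrite /= coordK // => Uq.
exact: chart_img_coord.
Qed.

Lemma dom_chart_at p : dom (chart_at p) p.
Proof. exact: (projT2 (cid (dom_cover p))). Qed.

Definition transition_diff c c' p : E -> E :=
  'd (coord c' \o coord_inv c) (coord c p).

Lemma to_chartE c p : to_chart c p = transition_diff (chart_at p) c p.
Proof. by []. Qed.

Lemma of_chartE c p : of_chart c p = transition_diff c (chart_at p) p.
Proof. by []. Qed.

Lemma transition_diff_linear c c' p (a : R) u v :
  transition_diff c c' p (a *: u + v) =
  a *: transition_diff c c' p u + transition_diff c c' p v.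
Proof. by rewrite /transition_diff linearP. Qed.

Lemma transition_differentiable c c' p : dom c p -> dom c' p ->
  differentiable (coord c' \o coord_inv c) (coord c p).
Proof.
move=> cp c'p; have h := smooth_diff (@transition_smooth R m Z c c').
by apply: h; exact: chart_img_coord.
Qed.

Lemma transition_diff_comp c1 c2 c3 p v : dom c1 p -> dom c2 p -> dom c3 p ->
  transition_diff c2 c3 p (transition_diff c1 c2 p v) = transition_diff c1 c3 p v.
Proof.
move=> p1 p2 p3; have d12 := transition_differentiable p1 p2.
have d23 := transition_differentiable p2 p3.
have e : (coord c2 \o coord_inv c1) (coord c1 p) = coord c2 p by rewrite /= coordK.
rewrite -e in d23.
have Uo : open (chart_img c1 (dom c2)) by apply: open_chart_img; exact: dom_open.
have nE : \forall x \near coord c1 p,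
    ((coord c3 \o coord_inv c2) \o (coord c2 \o coord_inv c1)) x =
    (coord c3 \o coord_inv c1) x.
  apply: (open_near_eq Uo) => [x [q [q1 q2] <-]|]; last exact: chart_img_coord.
  by rewrite /= !coordK.
have [_ dE] := near_eq_diff nE (differentiable_comp d12 d23).
have ddE := diff_comp d12 d23.
rewrite /transition_diff. 
rewrite [RHS](congr1 (fun h => h v) dE).
rewrite [RHS](congr1 (fun h => h v) ddE).
rewrite [RHS]/comp.
rewrite -e.
by [].
Qed.

Lemma transition_diff_id c p v : dom c p -> transition_diff c c p v = v.
Proof.
move=> cp; have Uo : open (chart_img c setT) by apply: open_chart_img; exact: openT.
have nE : \forall x \near coord c p, id x = (coord c \o coord_inv c) x.
  apply: (open_near_eq Uo) => [x [q [q1 _] <-]|]; last exact: chart_img_coord.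
  by rewrite /= coordK.
have did : is_diff (coord c p) (@id E) id by exact: is_diff_id.
have [_ dE] := near_eq_diff nE (@ex_diff _ _ _ _ _ _ _ did).
by rewrite /transition_diff dE diff_val.
Qed.

Lemma to_chart_linear c p (a : R) u v :
  to_chart c p (a *: u + v) = a *: to_chart c p u + to_chart c p v.
Proof. exact: transition_diff_linear. Qed.

Lemma of_chart_linear c p (a : R) u v :
  of_chart c p (a *: u + v) = a *: of_chart c p u + of_chart c p v.
Proof. exact: transition_diff_linear. Qed.

Lemma to_chartZ c p (a : R) u : to_chart c p (a *: u) = a *: to_chart c p u.
Proof. by rewrite /to_chart linearZ. Qed.

Lemma to_of_chart c c' p v : dom c p -> dom c' p ->
  to_chart c' p (of_chart c p v) = transition_diff c c' p v.
Proof.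
move=> cp c'p; apply: transition_diff_comp => //; exact: dom_chart_at.
Qed.

Lemma of_chartK c p v : dom c p -> to_chart c p (of_chart c p v) = v.
Proof. by move=> cp; rewrite to_of_chart // transition_diff_id. Qed.

Lemma to_chartK c p v : dom c p -> of_chart c p (to_chart c p v) = v.
Proof.
move=> cp; rewrite of_chartE to_chartE transition_diff_comp ?transition_diff_id //;
exact: dom_chart_at.
Qed.

Lemma map_of_chartK c p (s : seq E) : dom c p ->
  map (to_chart c p) (map (of_chart c p) s) = s.
Proof. by move=> cp; apply: mapK => v; exact: of_chartK. Qed.

Lemma map_to_chartK c p (s : seq E) : dom c p ->
  map (of_chart c p) (map (to_chart c p) s) = s.
Proof. by move=> cp; apply: mapK => v; exact: to_chartK. Qed.

Lemma to_chart_at p v : to_chart (chart_at p) p v = v.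
Proof. by apply: transition_diff_id; exact: dom_chart_at. Qed.

Lemma of_chart_at p v : of_chart (chart_at p) p v = v.
Proof. by apply: transition_diff_id; exact: dom_chart_at. Qed.

Lemma smooth_transition c c' :
  smooth_on (chart_img c' (dom c)) (coord c \o coord_inv c').
Proof. exact: (@transition_smooth R m Z c' c). Qed.

(** With [v] constant in the chart [c], this is a directional derivative of a transition map, smooth
    in the coordinates of [c], brought to those of [c'] by the inverse transition. *)
Lemma smooth_transition_diff c c' v : smooth_on (chart_img c' (dom c))
  (fun x => transition_diff c c' (coord_inv c' x) v).
Proof.
have o1 : open (chart_img c' (dom c)) by apply: open_chart_img; exact: dom_open.
have o2 : open (chart_img c (dom c')) by apply: open_chart_img; exact: dom_open.
apply: (smooth_eq (f := ('D_v (coord c' \o coord_inv c)) \o (coord c \o coord_inv c'))) => //.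
  move=> x [p [c'p cp] <-]; rewrite /= coordK // deriveE //.
  exact: transition_differentiable.
apply: (smooth_compv o1 o2) => [x [p [c'p cp] <-]| |].
- by rewrite /= coordK //; exact: chart_img_coord.
- exact: smooth_transition.
- by apply: smooth_derive; exact: smooth_transition.
Qed.

Lemma is_form_to_chart c p k (b : dform) : dom c p ->
  is_form k (fun s => b (map (to_chart c p) s)) <-> is_form k b.
Proof.
move=> cp; split=> h; last by apply: is_form_map => // *; exact: to_chart_linear.
have -> : b = fun s => b (map (to_chart c p) (map (of_chart c p) s)).
  by apply/funext => s; rewrite map_of_chartK.
by apply: (is_form_map _ h) => *; exact: of_chart_linear.
Qed.

Lemma is_form_rep c k (a : Z -> dform) x : is_form k (a (coord_inv c x)) ->
  is_form k (form_rep c a x).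
Proof. by apply: is_form_map => *; exact: of_chart_linear. Qed.

Lemma is_mvec_rep c k (G : Z -> mvec) x : dom c (coord_inv c x) ->
  is_mvec k (G (coord_inv c x)) -> is_mvec k (mvec_rep c G x).
Proof.
move=> cx Gk; split=> [d a b ak bk|a ak].
  by rewrite -(mvecP _ Gk) //; apply/is_form_to_chart.
by case: Gk => _ G0; apply: G0 => /(is_form_to_chart _ _ cx).
Qed.

Lemma form_rep_contract c (G : Z -> mvec) (a : Z -> dform) x :
  dom c (coord_inv c x) ->
  form_rep c (contract_field G a) x = contract (mvec_rep c G x) (form_rep c a x).
Proof.
move=> cx; apply/funext => s; rewrite /form_rep /contract_field /contract /mvec_rep.
congr (G _ _); apply/funext => t; by rewrite map_cat map_to_chartK.
Qed.

Lemma mvec_rep_wedge c k l (G G' : Z -> mvec) x : dom c (coord_inv c x) ->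
  mvec_rep c (fun p => wedge k l (G p) (G' p)) x =
  wedge k l (mvec_rep c G x) (mvec_rep c G' x).
Proof.
move=> cx; apply/funext => b; rewrite /mvec_rep /wedge.
rewrite (asbool_equiv_eq (is_form_to_chart _ _ cx)); case: asboolP => // _.
congr (G _ _); apply/funext => t; congr (G' _ _); apply/funext => u.
by rewrite map_cat.
Qed.

Lemma mvec_rep_dec c (s : Z -> seq E) x : dom c (coord_inv c x) ->
  mvec_rep c (fun p => decomposable (s p)) x =
  decomposable (map (to_chart c (coord_inv c x)) (s (coord_inv c x))).
Proof.
move=> cx; apply/funext => b; rewrite /mvec_rep /decomposable size_map.
by rewrite (asbool_equiv_eq (is_form_to_chart _ _ cx)).
Qed.

Lemma form_rep_at (a : Z -> dform) p :
  form_rep (chart_at p) a (coord (chart_at p) p) = a p.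
Proof.
apply/funext => s; rewrite /form_rep coordK; last exact: dom_chart_at.
by rewrite map_id_in // => v _; rewrite of_chart_at.
Qed.

Lemma vect_rep_at (X : Z -> E) p :
  vect_rep (chart_at p) X (coord (chart_at p) p) = X p.
Proof. by rewrite /vect_rep coordK ?to_chart_at //; exact: dom_chart_at. Qed.

(** * Smoothness of derived fields, cut-off functions and extension to the whole manifold *)

Lemma form_field_contract U k r G a : open U -> mvec_field_on U r G ->
  form_field_on U k a -> form_field_on U (k - r) (contract_field G a).
Proof.
move=> Uo [Gr Gs] [ak as_]; split=> [p Up|c s].
  by apply: is_form_contract; [exact: Gr|exact: ak].
have o1 : open (chart_img c U) by exact: open_chart_img.
apply: (smooth_eq (f := fun x => \sum_i (mvec_rep c G x (@bform R m r i) *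
   form_rep c a x (bvec i ++ s) : R^o))) => //.
  move=> x /chart_imgP[cx Ux _]; rewrite form_rep_contract //.
  rewrite (contractE (r := r) (k := k)) //.
    by apply: is_mvec_rep => //; exact: Gr.
  by apply: is_form_rep; exact: ak.
apply: smooth_sum => // i; apply: smooth_mul => //.
by apply: Gs; exact: is_form_bform.
Qed.

Lemma mvec_field_wedge U k l G G' : open U -> mvec_field_on U k G ->
  mvec_field_on U l G' -> mvec_field_on U (k + l) (fun p => wedge k l (G p) (G' p)).
Proof.
move=> Uo [Gk Gs] [Gl Gs']; split=> [p Up|c b bkl].
  by apply: is_mvec_wedge; [exact: Gk|exact: Gl].
have o1 : open (chart_img c U) by exact: open_chart_img.
apply: (smooth_eq (f := fun x => \sum_i \sum_j (mvec_rep c G x (@bform R m k i) *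
   (mvec_rep c G' x (@bform R m l j) * b (bvec i ++ bvec j)) : R^o))) => //.
  move=> x /chart_imgP[cx Ux _]; rewrite mvec_rep_wedge //.
  rewrite wedge_expand //; apply: is_mvec_rep => //; [exact: Gk|exact: Gl].
apply: smooth_sum => // i; apply: smooth_sum => // j; apply: smooth_mul => //.
  by apply: Gs; exact: is_form_bform.
apply: smooth_mul => //; last exact: smooth_cst.
by apply: Gs'; exact: is_form_bform.
Qed.

Lemma mvec_field_dec U (I : Type) (X : I -> Z -> E) (r : seq I) : open U ->
  (forall i c, smooth_on (chart_img c U) (vect_rep c (X i))) ->
  mvec_field_on U (size r) (fun p => decomposable [seq X i p | i <- r]).
Proof.
move=> Uo Xs; split=> [p Up|c b br].
  by have := is_mvec_decomposable [seq X i p | i <- r]; rewrite size_map.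
have o1 : open (chart_img c U) by exact: open_chart_img.
apply: (smooth_eq (f := fun x => b ([seq vect_rep c (X i) x | i <- r] ++ [::]))) => //.
  move=> x /chart_imgP[cx Ux _]; rewrite mvec_rep_dec // decomposableE ?size_map //.
  by rewrite cats0 -map_comp.
apply: (smooth_multilinear (A := fun=> b)) => //.
  by move=> _; exact: is_form_multilinear br.
  by move=> t; exact: smooth_cst.
by move=> i; exact: Xs.
Qed.

Lemma mvec_fieldP U k (a : R) G G' : open U -> mvec_field_on U k G ->
  mvec_field_on U k G' -> mvec_field_on U k (a *: G + G').
Proof.
move=> Uo [Gk Gs] [Gk' Gs']; split=> [p Up|c b bk].
  by apply: is_mvecP; [exact: Gk|exact: Gk'].
have o1 : open (chart_img c U) by exact: open_chart_img.
apply: (smooth_eq (f := fun x => a *: mvec_rep c G x b + mvec_rep c G' x b)) => //.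
by apply: smooth_add => //; [apply: smooth_scale => //; exact: Gs|exact: Gs'].
Qed.

Lemma mvec_field0 U k : open U -> mvec_field_on U k 0.
Proof.
by move=> Uo; split=> [p _|c b _]; [exact: is_mvec0|exact: smooth_cst].
Qed.

Definition smooth_fun (f : Z -> R) : Prop :=
  forall c, smooth_on (chart_img c setT) ((f \o coord_inv c) : E -> R^o).

Definition mvec_of_fun (f : Z -> R) : Z -> mvec := fun p => f p *: decomposable [::].

Lemma mvec_field_fun f : smooth_fun f -> mvec_field 0 (mvec_of_fun f).
Proof.
move=> fs; split=> [p _|c b b0].
  by apply: is_mvecZ; exact: (is_mvec_decomposable [::]).
have o1 : open (chart_img c setT) by apply: open_chart_img; exact: openT.
apply: (smooth_eq (f := fun x => (f (coord_inv c x) * b [::] : R^o))) => //.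
  move=> x /chart_imgP[cx _ _]; rewrite /mvec_rep /mvec_of_fun; toR; rewrite regE.
  by rewrite decomposableE //; apply/is_form_to_chart.
by apply: smooth_mul => //; [exact: fs|exact: smooth_cst].
Qed.

(** Extension by zero: [dom c] and the complement of [K] are open and cover Z, and [h] is smooth
    over the first and 0 over the second. *)
Lemma smooth_extend (V : normedModType R) c c' (K : set Z) (h : E -> V) :
  closed K -> K `<=` dom c -> smooth_on (chart_img c' (dom c)) h ->
  (forall x, chart_img c' setT x -> ~ K (coord_inv c' x) -> h x = 0) ->
  smooth_on (chart_img c' setT) h.
Proof.
move=> Kc Kd hs h0; apply: smooth_local => x c'x.
have [c'i _ ci] := chart_imgP c'x.
have [cx|cx] := pselect (dom c (coord_inv c' x)).
  by exists (chart_img c' (dom c)) => //; rewrite -ci; exact: chart_img_coord.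
have o1 : open (chart_img c' (~` K)).
  by apply: open_chart_img; exact: closed_openC.
exists (chart_img c' (~` K)).
  by rewrite -ci; apply: chart_img_coord => // /Kd.
apply: (smooth_eq (f := fun=> 0)) => //; last exact: smooth_cst.
move=> y c'y; rewrite h0 //; first exact: chart_imgS c'y.
by case: (chart_imgP c'y).
Qed.

(** The last two clauses are the two uses of a cut-off: they make global a function given in the
    chart and a vector field constant in the chart. *)
Lemma chart_bump p : let c := chart_at p in exists chi : Z -> R,
  [/\ chi p = 1,
      forall q, ~ dom c q -> chi q = 0,
      forall g : E -> R^o, smooth_on (chart_img c setT) g ->
        smooth_fun (fun q => chi q * g (coord c q))
    & forall v, vect_field (fun q => chi q *: of_chart c q v)].
Proof.
move=> c; have cp : dom c p := dom_chart_at p.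
have o1 : open (chart_img c setT) by apply: open_chart_img; exact: openT.
have [chi [chis chip [K [Kc KU K0]]]] := bump_function o1 (chart_img_coord cp I).
pose f q : R := if `[< dom c q >] then chi (coord c q) else 0.
pose KZ := coord_inv c @` K.
(* Here the Hausdorff property enters: the image of the compact [K] in Z is compact, hence
   closed. *)
have KZc : closed KZ.
  apply: (compact_closed (@point_hausdorff _ _ Z)); apply: continuous_compact => //.
  apply: continuous_in_subspaceT => x; rewrite inE => /KU.
  by rewrite chart_imgT; exact: coord_inv_continuous.
have KZd : KZ `<=` dom c by move=> _ [x /KU /chart_imgP[h _ _] <-].
have fK q : ~ KZ q -> f q = 0.
  rewrite /f; case: asboolP => // cq nq; apply: K0 => Kq; apply: nq.
  by exists (coord c q) => //; rewrite coordK.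
have fs c' : smooth_on (chart_img c' (dom c)) ((f \o coord_inv c') : E -> R^o).
  have o2 : open (chart_img c' (dom c)) by apply: open_chart_img; exact: dom_open.
  apply: (smooth_eq (f := chi \o (coord c \o coord_inv c'))) => //.
    by move=> x /chart_imgP[_ cx _]; rewrite /= /f; case: asboolP.
  apply: (smooth_comp (W := setT)) => //; first exact: openT.
  exact: smooth_transition.
exists f; split.
- by rewrite /f; case: asboolP.
- by move=> q cq; rewrite /f; case: asboolP.
- move=> g gs c'; apply: (smooth_extend (c := c) KZc KZd).
    have o2 : open (chart_img c' (dom c)) by apply: open_chart_img; exact: dom_open.
    apply: smooth_mul => //.
    apply: (smooth_comp (f := coord c \o coord_inv c') (W := chart_img c setT)) => //.
      by move=> x /chart_imgP[_ cx _]; exact: chart_img_coord.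
    exact: smooth_transition.
  by move=> x _ nK; rewrite /= fK // mul0r.
- move=> v c'; rewrite -chart_imgT; apply: (smooth_extend (c := c) KZc KZd).
    have o2 : open (chart_img c' (dom c)) by apply: open_chart_img; exact: dom_open.
    apply: (smooth_eq (f := fun x => (f (coord_inv c' x)) *:
      transition_diff c c' (coord_inv c' x) v)) => //.
      by move=> x /chart_imgP[c'x cx _]; rewrite /vect_rep to_chartZ to_of_chart.
    apply: (smooth_scalev (f := f \o coord_inv c')) => //.
    exact: smooth_transition_diff.
  by move=> x _ nK; rewrite /vect_rep fK // scale0r /to_chart linear0.
Qed.

Lemma vect_field_through p v : exists2 X : Z -> E, vect_field X & X p = v.
Proof.
have [chi [chip _ _ chiv]] := chart_bump p.
by eexists; first exact: (chiv v); rewrite /= chip scale1r of_chart_at.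
Qed.

End Charts.

(** * The multi-Dirac structure *)

Section Graph.
Variables (R : realType) (m : nat) (Z : manifold R m).
Local Notation E := 'rV[R]_m.
Local Notation dform := (dform R m).
Local Notation mvec := (mvec R m).
Implicit Types (c : atlas Z) (p q : Z) (U : set Z).

Lemma form_field_sub U k (a : Z -> dform) : form_field k a -> form_field_on U k a.
Proof.
move=> [ak asm]; split=> [p _|c s]; first exact: ak.
by apply: smooth_sub (asm c s) => x; exact: chart_imgS.
Qed.

Lemma contract_sum (I : Type) (r : seq I) (P : pred I) (F : I -> mvec) (a : dform) :
  contract (\sum_(i <- r | P i) F i) a = \sum_(i <- r | P i) contract (F i) a.
Proof. by apply/funext => s; toR; rewrite /contract !regE. Qed.

Lemma mvec_chart_basis c q r (G : mvec) : dom c q -> is_mvec r G ->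
  G = \sum_i (G (fun s => @bform R m r i (map (to_chart c q) s)) : R) *:
        (decomposable (map (of_chart c q) (bvec i)) : mvec).
Proof.
move=> cq Gr; pose H := mvec_rep c (fun=> G) (coord c q).
have Hr : is_mvec r H by apply: is_mvec_rep; rewrite ?coordK.
have HE b : H b = G (fun s => b (map (to_chart c q) s)) by rewrite /H /mvec_rep coordK.
apply/funext => a; toR; rewrite regE; have [ar|ar] := pselect (is_form r a).
  have aO : is_form r (fun s => a (map (of_chart c q) s)).
    by apply: (is_form_map _ ar) => *; exact: of_chart_linear.
  have -> : G a = H (fun s => a (map (of_chart c q) s)).
    rewrite HE; congr (G _); apply/funext => s.
    by rewrite map_to_chartK.
  rewrite (mvec_expand Hr aO); apply: eq_bigr => i _.
  by rewrite regE HE decomposableE // size_map size_bvec.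
case: (Gr) => _ -> //; rewrite big1 // => i _; rewrite regE.
by rewrite /decomposable size_map size_bvec; case: asboolP => // _; rewrite mulr0.
Qed.

Section Frame.
Variables (n : nat) (Omega : Z -> dform).
Hypothesis Omega_form : form_field n.+1 Omega.

Definition graph_frame r c (i : 'I_(nbasis R m r)) q : mvec * dform :=
  let G : mvec := decomposable (map (of_chart c q) (bvec i)) in
  (G, contract G (Omega q)).

Lemma graph_frame_sum r c (a : 'I_(nbasis R m r) -> R) q :
  \sum_i a i *: graph_frame c i q =
  let G : mvec := \sum_i a i *: (decomposable (map (of_chart c q) (bvec i)) : mvec) in
  (G, contract G (Omega q)).
Proof.
rewrite /= contract_sum.
elim: (index_enum _) => [|i s IH]; first by rewrite !big_nil.
by rewrite !big_cons IH.
Qed.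

Lemma graph_frame_section r c i :
  sectionL_on n (dom c) r (@graph_frame r c i).
Proof.
have Uo : open (dom c) by exact: dom_open.
have Gf : mvec_field_on (dom c) r (fun q => decomposable (map (of_chart c q) (bvec i))).
  have := @mvec_field_dec R m Z (dom c) _ (fun v q => of_chart c q v) (@bvec R m r i) Uo.
  rewrite size_bvec; apply => v c'.
  apply: (smooth_eq (f := fun x => transition_diff c c' (coord_inv c' x) v)).
  - by apply: open_chart_img; exact: dom_open.
  - by move=> x /chart_imgP[c'x cx _]; rewrite /vect_rep to_of_chart.
  - exact: smooth_transition_diff.
split=> //; apply: form_field_contract => //.
exact: form_field_sub.
Qed.

Lemma subbundle_graph r : subbundle n r (graph_dirac Omega r).
Proof.
move=> p; pose c := chart_at p.
exists (dom c), (nbasis R m r), (@graph_frame r c).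
split; [exact: dom_open|exact: dom_chart_at|by move=> i; exact: graph_frame_section| |].
- move=> q cq a; rewrite graph_frame_sum => -[/= aG _] j.
  (* The dual form [bform j], carried to the tangent space at [q], isolates the coefficient
     [a j]. *)
  have := congr1 (fun G : mvec => G (fun s => bform j (map (to_chart c q) s))) aG.
  rewrite /= regE (bigD1 j) //= big1 => [|i ij].
    rewrite regE decomposableE ?size_map ?size_bvec.
      by rewrite map_of_chartK // bform_bvec eqxx mulr1 addr0.
    by apply/is_form_to_chart => //; exact: is_form_bform.
  rewrite regE decomposableE ?size_map ?size_bvec.
    by rewrite map_of_chartK // bform_bvec eq_sym (negPf ij) mulr0.
  by apply/is_form_to_chart => //; exact: is_form_bform.
- move=> q cq; apply/seteqP; split=> [_ [G Gr ->]|_ [a _ <-]].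
    exists (fun i => G (fun s => bform i (map (to_chart c q) s))) => //.
    by rewrite graph_frame_sum /= -(mvec_chart_basis cq Gr).
  rewrite graph_frame_sum; eexists; last by [].
  apply: is_mvec_sum => i _; apply: is_mvecZ.
  by have := is_mvec_decomposable (map (of_chart c q) (bvec i));
     rewrite size_map size_bvec.
Qed.

(** To recover [S'] at a list [t] of length [n.+1 - s], cut [t] after [r] vectors, which
    [r + s <= n.+1] allows: orthogonality to the decomposable of the first part, evaluated at the
    second, is the required equation up to a factor. Conversely, contractions commute up to the sign
    in the pairing, so its two terms cancel. *)
Lemma graph_orthogonal r s p : (r + s <= n.+1)%N ->
  orthogonal_in n r s (graph_dirac Omega r p) = graph_dirac Omega s p.
Proof.
move=> rs; have Op : is_form n.+1 (Omega p) by case: Omega_form => h _; exact: h.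
apply/seteqP; split=> [[G' S'] [[/= G's S'f] orth]|_ [G' G's ->]].
  exists G' => //; congr (_, _); apply/funext => t.
  have [ts|ts] := eqVneq (size t) (n.+1 - s)%N; last first.
    by rewrite (is_form_size S'f) // (is_form_size (is_form_contract G's Op)).
  pose u := take r t; pose v := drop r t.
  have ur : size u = r by rewrite size_takel // ts; lia.
  have := orth (decomposable u, contract (decomposable u) (Omega p)).
  have ud : is_mvec r (decomposable u) by rewrite -ur; exact: is_mvec_decomposable.
  move=> /(_ (ex_intro2 _ _ _ ud erefl)) /(congr1 (fun a : dform => a v)).
  rewrite /pairing /=; rewrite !regE (contract_comm G's ud Op) regE.
  rewrite (contract_dec _ _ (is_form_contract G's Op)) (contract_dec _ _ S'f).
  rewrite cat_take_drop mulnC mulN1r.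
  have s0 : (-1) ^+ (r * s) != 0 :> R by rewrite signr_eq0.
  move=> /eqP; rewrite mulf_eq0 invr_eq0 pnatr_eq0 /= mulNr -mulrBr mulf_eq0.
  by rewrite (negPf s0) /= subr_eq0 => /eqP.
split=> [|_ [G Gr ->]]; first by split=> //=; exact: is_form_contract.
rewrite /pairing /= (contract_comm G's Gr Op) mulN1r mulnC scaleNr subrr.
exact: scaler0.
Qed.

Lemma multi_dirac_graph : multi_dirac n (graph_dirac Omega).
Proof.
split=> [r _|r s _ _ rs p]; first exact: subbundle_graph.
exact: graph_orthogonal.
Qed.

End Frame.
End Graph.

(** * The exterior derivative in coordinates *)

Section AlternatingSum.
Variables (R : realType) (m : nat).
Local Notation E := 'rV[R]_m.
Local Notation dform := (dform R m).
Implicit Types (F : E -> dform) (x : E).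

(** The exterior derivative in coordinates, of an arbitrary family: with no degree or alternation
    built in, it also applies to families with some slots already filled. *)
Definition dsum F x : dform := fun s =>
  \sum_(0 <= i < size s) (-1) ^+ i *
    'D_(s`_i) (fun y => F y (take i s ++ drop i.+1 s) : R^o) x.

Definition diff_family F x := forall s, differentiable (fun y => F y s : R^o) x.

Lemma derive_linear (f : E -> R^o) x (c : R) u v : differentiable f x ->
  'D_(c *: u + v) f x = c * 'D_u f x + 'D_v f x.
Proof. by move=> df; rewrite !deriveE // linearP. Qed.

(** The sum splits according to the block that contains the direction of differentiation; the sign
    counts the vectors of [s1] that are jumped over. *)
Lemma dsum_cat F x s1 s2 : dsum F x (s1 ++ s2) =
  dsum (fun y t => F y (t ++ s2)) x s1 +
  (-1) ^+ size s1 * dsum (fun y t => F y (s1 ++ t)) x s2.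
Proof.
rewrite /dsum size_cat (@big_cat_nat _ _ _ (size s1)) ?leq_addr //=; congr (_ + _).
  rewrite !big_nat; apply: eq_bigr => i /= ilt; congr (_ * _).
  rewrite nth_cat take_cat drop_cat ilt; congr ('D__ _ x); apply/funext => y.
  rewrite -catA; case: ltnP => // h.
  have -> : i.+1 = size s1 by apply/eqP; rewrite eqn_leq ilt h.
  by rewrite subnn drop0 drop_size.
rewrite -{1}[size s1]add0n big_addn addKn big_distrr /=; apply: eq_bigr => i _.
rewrite mulrA -exprD addnC; congr (_ * _).
rewrite nth_cat take_cat drop_cat ltnNge leq_addr /= addKn -addnS ltnNge leq_addr /=.
by rewrite addKn; congr ('D__ _ x); apply/funext => y; rewrite -catA.
Qed.

(** Cartan's formula [i_w d = L_w - d i_w] for a constant vector field [w], whose Lie derivative is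
    the directional derivative. *)
Lemma dsum_cons F x w s : dsum F x (w :: s) =
  'D_w (fun y => F y s : R^o) x - dsum (fun y t => F y (w :: t)) x s.
Proof.
rewrite -cat1s dsum_cat /= expr1 mulN1r; congr (_ - _).
by rewrite /dsum /= big_nat1 expr0 mul1r.
Qed.

Lemma dsum_near F F' x : (forall s, \forall y \near x, F y s = F' y s) ->
  dsum F x = dsum F' x.
Proof.
move=> FF'; apply/funext => s; apply: eq_bigr => i _; congr (_ * _).
exact: near_eq_derive.
Qed.

Lemma dsum_linear F F' x (c : R) : diff_family F x -> diff_family F' x ->
  dsum (fun y => c *: F y + F' y) x = c *: dsum F x + dsum F' x.
Proof.
move=> dF dF'; apply/funext => s; toR; rewrite !regE /dsum big_distrr -big_split /=.
apply: eq_bigr => i _.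
set t := take i s ++ _.
have -> : (fun y => (c *: F y + F' y) t : R^o) =
  (c *: (fun y => F y t : R^o)) + (fun y => F' y t : R^o) by [].
have df : differentiable (c *: (fun y => F y t : R^o)) x by exact: differentiableZ.
rewrite deriveD; [|exact: diff_derivable|exact: diff_derivable].
rewrite deriveZ; last exact: diff_derivable.
by rewrite -[_ *: _]/(_ * _); ring.
Qed.

Lemma dsum0 F x : (forall y s, F y s = 0) -> dsum F x = 0.
Proof.
move=> F0; apply/funext => s; rewrite /dsum big1 // => i _.
have -> : (fun y => F y (take i s ++ drop i.+1 s) : R^o) = cst 0.
  by apply/funext => y; exact: F0.
by rewrite derive_cst mulr0.
Qed.

(** For alternation, the terms differentiating along a vector other than the two copies of [u] still
    contain both copies and vanish; the two remaining terms cancel by [form_move]. *)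
Lemma is_form_dsum k F x : (forall y, is_form k (F y)) -> diff_family F x ->
  is_form k.+1 (dsum F x).
Proof.
move=> Fk dF; split=> [s sk|s1 s2 c u v|s1 s2 s3 u].
- rewrite /dsum big_nat big1 // => i /= ilt.
  have -> : (fun y => F y (take i s ++ drop i.+1 s) : R^o) = cst 0.
    apply/funext => y; apply: (is_form_size (Fk y)).
    rewrite size_cat size_drop size_takel 1?ltnW //.
    by apply: contraNneq sk => <-; apply/eqP; lia.
  by rewrite derive_cst mulr0.
- rewrite !dsum_cat !dsum_cons derive_linear //.
  have -> : (fun y t => F y (t ++ (c *: u + v) :: s2)) =
      fun y => c *: ((fun t => F y (t ++ u :: s2)) : dform) + (fun t => F y (t ++ v :: s2)).
    by apply/funext => y; apply/funext => t; case: (Fk y) => _ -> _.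
  have -> : (fun y t => F y (s1 ++ (c *: u + v) :: t)) =
      fun y => c *: ((fun t => F y (s1 ++ u :: t)) : dform) + (fun t => F y (s1 ++ v :: t)).
    by apply/funext => y; apply/funext => t; case: (Fk y) => _ -> _.
  have d1 w : diff_family (fun y t => F y (t ++ w :: s2)) x by move=> t; exact: dF.
  have d2 w : diff_family (fun y t => F y (s1 ++ w :: t)) x by move=> t; exact: dF.
  by toR; rewrite !dsum_linear // !regE; ring.
- rewrite dsum_cat dsum_cons dsum_cat dsum_cons.
  have z1 : dsum (fun y t => F y (t ++ u :: s2 ++ u :: s3)) x = 0.
    by apply: dsum0 => y t; case: (Fk y) => _ _ ->.
  have z2 : dsum (fun y t => F y (s1 ++ u :: t ++ u :: s3)) x = 0.
    by apply: dsum0 => y t; case: (Fk y) => _ _ ->.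
  have z3 : dsum (fun y t => F y (s1 ++ u :: s2 ++ u :: t)) x = 0.
    by apply: dsum0 => y t; case: (Fk y) => _ _ ->.
  rewrite z1 z2 z3; toR; rewrite !regE.
  have -> : (fun y => F y (s1 ++ s2 ++ u :: s3) : R^o) =
      (-1) ^+ size s2 *: (fun y => F y (s1 ++ u :: s2 ++ s3) : R^o).
    by apply/funext => y; rewrite (form_move _ _ _ _ (Fk y)).
  rewrite deriveZ; last exact: diff_derivable.
  by rewrite -[_ *: _]/(_ * _); ring.
Qed.

(** The wedge product of the differential of [f] at [x] with [b]. Accordingly, [wsum_cons] is the
    antiderivation rule of contraction and [dsum_mul] the Leibniz rule of d. *)
Definition wsum (f : E -> R^o) (b : dform) x : dform := fun s =>
  \sum_(0 <= i < size s) (-1) ^+ i * ('D_(s`_i) f x * b (take i s ++ drop i.+1 s)).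

Lemma wsum_cons f b x w s :
  wsum f b x (w :: s) = 'D_w f x * b s - wsum f (fun t => b (w :: t)) x s.
Proof.
rewrite /wsum /= big_nat_recl //= expr0 mul1r drop0; congr (_ + _).
by rewrite -sumrN; apply: eq_bigr => i _; rewrite exprS; ring.
Qed.

Lemma wsumZ f b x (c : R) s : wsum f (c *: b) x s = c * wsum f b x s.
Proof. by rewrite /wsum big_distrr /=; apply: eq_bigr => i _; rewrite regE; ring. Qed.

Lemma dsum_mul (f : E -> R^o) F x s : differentiable f x -> diff_family F x ->
  dsum (fun y => (f y : R) *: F y) x s = f x * dsum F x s + wsum f (F x) x s.
Proof.
move=> df dF; rewrite /dsum /wsum big_distrr -big_split /=; apply: eq_bigr => i _.
set t := take i s ++ _.
have -> : (fun y => ((f y : R) *: F y) t : R^o) = f * (fun y => F y t : R^o) by [].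
rewrite deriveM; [|exact: diff_derivable|exact: diff_derivable].
by rewrite -![_ *: _]/(_ * _); ring.
Qed.

Lemma differentiable_slot F (X : E -> E) x t : (forall y, multilinear (F y)) ->
  diff_family F x -> differentiable X x ->
  differentiable (fun y => F y (X y :: t) : R^o) x.
Proof.
move=> Fl dF dX.
have -> : (fun y => F y (X y :: t) : R^o) =
    \sum_j (fun y => X y 0 j : R^o) * (fun y => F y (delta_mx 0 j :: t) : R^o).
  apply/funext => y; rewrite fct_sumE (multilinear_slot [::] _ _ (Fl y)).
  by apply: eq_bigr.
apply: differentiable_sum => j; apply: differentiableM; last exact: dF.
exact: differentiable_entry.
Qed.

(** Product rule for a moving form and a moving vector. Expanding the slot over the basis both for
    [X] and for the constant field [X x] leaves, as difference, the term in the derivative of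
    [X]. *)
Lemma derive_slot F (X : E -> E) x t v : (forall y, multilinear (F y)) ->
  diff_family F x -> differentiable X x ->
  'D_v (fun y => F y (X y :: t) : R^o) x =
  'D_v (fun y => F y (X x :: t) : R^o) x + F x ('D_v X x :: t).
Proof.
move=> Fl dF dX.
have e (Y : E -> E) : differentiable Y x -> 'D_v (fun y => F y (Y y :: t) : R^o) x =
    \sum_j (Y x 0 j * 'D_v (fun y => F y (delta_mx 0 j :: t) : R^o) x +
      F x (delta_mx 0 j :: t) * 'D_v Y x 0 j).
  move=> dY; have -> : (fun y => F y (Y y :: t) : R^o) =
      \sum_j (fun y => Y y 0 j : R^o) * (fun y => F y (delta_mx 0 j :: t) : R^o).
    apply/funext => y; rewrite fct_sumE (multilinear_slot [::] _ _ (Fl y)).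
    by apply: eq_bigr.
  rewrite derive_sum => [|j]; last first.
    by apply: diff_derivable; apply: differentiableM; [exact: differentiable_entry|exact: dF].
  apply: eq_bigr => j _; rewrite deriveM; first 1 last.
  - by apply: diff_derivable; exact: differentiable_entry.
  - by apply: diff_derivable; exact: dF.
  by rewrite derive_entry.
rewrite (e X dX) (e (cst (X x))) //.
rewrite derive_cst (multilinear_slot [::] _ _ (Fl x)) -big_split /=.
by apply: eq_bigr => j _; rewrite mxE; ring.
Qed.

(* Cartan's formula [L_X i_Y - i_Y L_X = i_[X, Y]], every Lie derivative being
   expanded as [d i + i d]. *)
Lemma cartan_bracket k F (X Y : E -> E) x s : (forall y, is_form k (F y)) ->
  diff_family F x -> differentiable X x -> differentiable Y x ->
  dsum (fun y t => F y (Y y :: X y :: t)) x s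
  + dsum (fun y t => F y (Y y :: t)) x (X x :: s)
  - dsum (fun y t => F y (X y :: t)) x (Y x :: s)
  - dsum F x (X x :: Y x :: s) =
  F x (('D_(X x) Y x - 'D_(Y x) X x) :: s).
Proof.
move=> Fk dF dX dY; rewrite !dsum_cons.
have Fl y : multilinear (F y) by exact: is_form_multilinear (Fk y).
have [_ Fx _] := Fk x.
have -> : F x (('D_(X x) Y x - 'D_(Y x) X x) :: s) =
    F x ('D_(X x) Y x :: s) - F x ('D_(Y x) X x :: s).
  by have := Fx [::] s (-1) ('D_(Y x) X x) ('D_(X x) Y x);
     rewrite /= scaleN1r addrC => ->; rewrite mulN1r addrC.
rewrite (@derive_slot F Y x s (X x) Fl dF dY) (@derive_slot F X x s (Y x) Fl dF dX).
have FY y : multilinear (fun t => F y (Y y :: t)).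
  exact: (multilinear_prefix [:: Y y]).
have dFY : diff_family (fun y t => F y (Y y :: t)) x.
  by move=> t; exact: differentiable_slot.
(* Freezing [X] at [x] in the first and third sums leaves, for each direction v, the values of [F x]
   on (Y, D_v X, t) and on (D_v X, Y, t), which cancel by antisymmetry. *)
have e : dsum (fun y t => F y (Y y :: X y :: t)) x s
  - dsum (fun y t => F y (Y y :: X x :: t)) x s
  + dsum (fun y t => F y (X y :: Y x :: t)) x s
  - dsum (fun y t => F y (X x :: Y x :: t)) x s = 0.
  rewrite /dsum -sumrB -big_split -sumrB /= big1 // => i _.
  set t := take i s ++ _; set v := s`_i.
  rewrite (@derive_slot (fun y t => F y (Y y :: t)) X x t v FY dFY dX).
  rewrite (@derive_slot F X x (Y x :: t) v Fl dF dX).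
  have := form_swap [::] (Y x) ('D_v X x) t (Fk x); rewrite /= => ->.
  ring.
move: e; lra.
Qed.

End AlternatingSum.

(** * Commutators of Lie derivatives and contractions *)

Section FieldCalculus.
Variables (R : realType) (m : nat) (Z : manifold R m).
Local Notation E := 'rV[R]_m.
Local Notation dform := (dform R m).
Local Notation mvec := (mvec R m).
Implicit Types (p q : Z) (a b : Z -> dform) (G : Z -> mvec) (X Y : Z -> E).
Local Notation crd p := (coord (chart_at p) p).
Local Notation frep p a := (form_rep (chart_at p) a).

Lemma nbhs_chart_img p : nbhs (crd p) (chart_img (chart_at p) setT).
Proof.
apply: open_nbhs_nbhs; split; first by apply: open_chart_img; exact: openT.
by apply: chart_img_coord => //; exact: dom_chart_at.
Qed.

Lemma chart_img_crd p : chart_img (chart_at p) setT (crd p).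
Proof. exact: nbhs_singleton (nbhs_chart_img p). Qed.

Lemma ext_dE a p : ext_d a p = dsum (frep p a) (crd p).
Proof. by apply/funext => s; rewrite /dsum big_mkord. Qed.

Lemma form_fieldE k a p : form_field k a -> is_form k (a p).
Proof. by case=> h _; exact: h. Qed.

Lemma mvec_fieldE k G p : mvec_field k G -> is_mvec k (G p).
Proof. by case=> h _; exact: h. Qed.

Lemma form_field_diff k a p : form_field k a -> diff_family (frep p a) (crd p).
Proof.
move=> [_ asm] s; apply: (smooth_diff (asm (chart_at p) s)).
exact: chart_img_crd.
Qed.

Lemma form_rep_form k a p x : form_field k a -> is_form k (frep p a x).
Proof. by move=> ak; apply: is_form_rep; exact: form_fieldE ak. Qed.

Lemma is_form_ext_d k a p : form_field k a -> is_form k.+1 (ext_d a p).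
Proof.
move=> ak; rewrite ext_dE; apply: is_form_dsum; last exact: form_field_diff ak.
by move=> y; exact: form_rep_form.
Qed.

Lemma ext_d_linear k (c : R) a b p : form_field k a -> form_field k b ->
  ext_d (c *: a + b) p = c *: ext_d a p + ext_d b p.
Proof.
move=> ak bk; rewrite !ext_dE -dsum_linear //; first exact: form_field_diff ak.
exact: form_field_diff bk.
Qed.

Lemma ext_d0 p : ext_d (0 : Z -> dform) p = 0.
Proof. by rewrite ext_dE; apply: dsum0. Qed.

Lemma form_field0 k : form_field k (0 : Z -> dform).
Proof. by split=> [p _|c s]; [exact: is_form0|exact: smooth_cst]. Qed.

Lemma ext_dZ k (c : R) a p : form_field k a -> ext_d (c *: a) p = c *: ext_d a p.
Proof.
move=> ak; have := ext_d_linear c p ak (form_field0 k).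
by rewrite ext_d0 !addr0.
Qed.

Lemma form_field_contractT k r G a : mvec_field r G -> form_field k a ->
  form_field (k - r) (contract_field G a).
Proof. by move=> Gr ak; apply: form_field_contract => //; exact: openT. Qed.

Lemma lie_derivE r G a p : lie_deriv r G a p =
  ext_d (contract_field G a) p - (-1) ^+ r *: contract (G p) (ext_d a p).
Proof. by []. Qed.

(** The term [d i_G a] has the degree [(k - r).+1], which equals [k.+1 - r] only for [r <= k]; for
    larger [r] that term is 0. *)
Lemma is_form_lie k r G a p : mvec_field r G -> form_field k a ->
  is_form (k.+1 - r) (lie_deriv r G a p).
Proof.
move=> Gr ak; rewrite lie_derivE; apply: is_formB; last first.
  by apply: is_formZ; apply: is_form_contract; [exact: mvec_fieldE Gr|exact: is_form_ext_d].
have [rk|kr] := leqP r k.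
  by rewrite subSn //; apply: is_form_ext_d; exact: form_field_contractT.
have -> : contract_field G a = 0.
  apply/funext => q; apply: (contract_small (mvec_fieldE q Gr) (form_fieldE q ak)).
  exact: kr.
by rewrite ext_d0; exact: is_form0.
Qed.

(* The graded commutator of [L_G] and [i_G'], which computes the contraction with
   the Schouten-Nijenhuis bracket; the exponent [r - 1] is written [r.+1]. *)
Definition comm r s G G' a p : dform :=
  (-1) ^+ (r.+1 * s) *: lie_deriv r G (contract_field G' a) p
  - contract (G' p) (lie_deriv r G a p).

Lemma contract_field_comm r s k G G' a : mvec_field r G -> mvec_field s G' ->
  form_field k a -> contract_field G (contract_field G' a) =
    (-1) ^+ (r * s) *: contract_field G' (contract_field G a).
Proof.
move=> Gr Gs ak; apply/funext => q.
exact: (contract_comm (mvec_fieldE q Gr) (mvec_fieldE q Gs) (form_fieldE q ak)).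
Qed.

Lemma sign_odd n : (-1) ^+ n = (-1) ^+ odd n :> R.
Proof. by rewrite signr_odd. Qed.

Lemma commE r s k G G' a p t : mvec_field r G -> mvec_field s G' -> form_field k a ->
  comm r s G G' a p t =
  (-1) ^+ (r.+1 * s) * (ext_d (contract_field G (contract_field G' a)) p t
     - (-1) ^+ r * contract (G p) (ext_d (contract_field G' a) p) t)
  - (contract (G' p) (ext_d (contract_field G a) p) t
     - (-1) ^+ r * contract (G' p) (contract (G p) (ext_d a p)) t).
Proof.
move=> Gr Gs ak; rewrite /comm !lie_derivE.
have Gp := mvec_fieldE p Gr; have G'p := mvec_fieldE p Gs.
have dak := is_form_ext_d p ak.
have f2 := is_formZ ((-1) ^+ r) (is_form_contract Gp dak).
(* Read off from [is_form_lie] by adding back the second term, so that the case [k < r] of truncated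
   subtraction is not met again. *)
have f1 : is_form (k.+1 - r) (ext_d (contract_field G a) p).
  have := is_form_lie p Gr ak; rewrite lie_derivE => h.
  by rewrite -[ext_d _ _](subrK ((-1) ^+ r *: contract (G p) (ext_d a p))); exact: is_formD.
rewrite (contractB G'p f1 f2) (contractZ _ G'p (is_form_contract Gp dak)).
by toR; rewrite !regE.
Qed.

(** Exchanging the fields permutes the four terms of [commE], the first and the last after commuting
    two contractions. All signs depend only on the parities of [r] and [s], which leaves four
    cases. *)
Lemma comm_sym r s k G G' a p : mvec_field r G -> mvec_field s G' ->
  form_field k a ->
  comm r s G G' a p = - ((-1) ^+ (r.+1 * s.+1) *: comm s r G' G a p).
Proof.
move=> Gr Gs ak; apply/funext => t; toR; rewrite !regE !(commE _ _ _ _ ak) //.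
rewrite (contract_field_comm Gr Gs ak).
rewrite (ext_dZ (k := k - r - s)); last by do 2! apply: form_field_contractT => //.
have dak := is_form_ext_d p ak.
rewrite (contract_comm (mvec_fieldE p Gr) (mvec_fieldE p Gs) dak) !regE.
rewrite (sign_odd (r.+1 * s)) (sign_odd (s.+1 * r)) (sign_odd (r.+1 * s.+1)).
rewrite (sign_odd (r * s)) (sign_odd r) (sign_odd s) !oddM /=.
by case: (odd r); case: (odd s); rewrite /= ?expr0 ?expr1; ring.
Qed.

(** * The commutator on functions and vector fields *)

Lemma contract_mvec_of_fun (f : Z -> R) k a q : form_field k a ->
  contract_field (mvec_of_fun f) a q = f q *: a q.
Proof.
move=> ak; rewrite /contract_field /mvec_of_fun; apply/funext => t; toR.
rewrite regE -[a q t]/(a q ([::] ++ t)) -(contract_dec [::] t (form_fieldE q ak)).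
by [].
Qed.

Lemma wedge_fun (c : R) s (H : mvec) : is_mvec s H ->
  wedge 0 s (c *: decomposable [::]) H = c *: H.
Proof.
move=> Hs; have d0 : is_mvec 0 (c *: decomposable [::] : mvec).
  by apply: is_mvecZ; exact: (is_mvec_decomposable [::]).
apply/funext => b; have [bs|bs] := pselect (is_form s b); last first.
  by rewrite /wedge; case: asboolP => // _; toR; rewrite regE; case: Hs => _ ->; rewrite ?mulr0.
have e (K : mvec) (b' : dform) : contract K b' [::] = K b'.
  by rewrite /contract; congr (K _); apply/funext => u; rewrite cats0.
rewrite -e (contract_wedge d0 Hs bs).
have -> : contract (c *: decomposable [::]) b = c *: b.
  apply/funext => t; toR; rewrite regE -[b t]/(b ([::] ++ t)) -(contract_dec [::] t bs).
  by [].
by rewrite (contractZ _ Hs bs); toR; rewrite !regE e.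
Qed.

Lemma form_rep_contract_vec k X a p y : form_field k a ->
  chart_img (chart_at p) setT y ->
  frep p (contract_field (fun q => decomposable [:: X q]) a) y =
  fun t => frep p a y (vect_rep (chart_at p) X y :: t).
Proof.
move=> ak /chart_imgP[cy _ _]; rewrite form_rep_contract // mvec_rep_dec //=.
by apply/funext => t; rewrite (contract_dec _ _ (form_rep_form p y ak)).
Qed.

Lemma vect_field_mvec X : vect_field X -> mvec_field 1 (fun q => decomposable [:: X q]).
Proof.
move=> Xs; apply: (@mvec_field_dec R m Z setT unit (fun _ => X) [:: tt]).
  exact: openT.
by move=> _ c; rewrite chart_imgT; exact: Xs.
Qed.

Lemma ext_d_contract_vec k X a p : form_field k a ->
  ext_d (contract_field (fun q => decomposable [:: X q]) a) p =
  dsum (fun y t => frep p a y (vect_rep (chart_at p) X y :: t)) (crd p).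
Proof.
move=> ak; rewrite ext_dE; apply: dsum_near => s.
apply: filterS (nbhs_chart_img p) => y cy.
by rewrite (form_rep_contract_vec _ ak cy).
Qed.

Lemma vect_field_diff X p : vect_field X ->
  differentiable (vect_rep (chart_at p) X) (crd p).
Proof.
move=> Xs; apply: (smooth_diff (Xs (chart_at p))).
by rewrite -chart_imgT; exact: chart_img_crd.
Qed.

Lemma comm_vect k X Y a p : vect_field X -> vect_field Y -> form_field k a ->
  comm 1 1 (fun q => decomposable [:: X q]) (fun q => decomposable [:: Y q]) a p =
  contract (decomposable [:: lie_bracket X Y p]) (a p).
Proof.
move=> Xs Ys ak; apply/funext => s.
have Xf := vect_field_mvec Xs; have Yf := vect_field_mvec Ys.
rewrite (commE _ _ Xf Yf ak) (contract_dec _ _ (form_fieldE p ak)) /=.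
have Yak := form_field_contractT Yf ak; have Xak := form_field_contractT Xf ak.
have dak := is_form_ext_d p ak.
rewrite (contract_dec _ _ (is_form_ext_d p Yak)) (contract_dec _ _ (is_form_ext_d p Xak)).
have dX := is_form_contract (is_mvec_decomposable [:: X p]) dak.
rewrite (contract_dec _ _ dX) (contract_dec _ _ dak) /= (ext_d_contract_vec _ _ Yak).
rewrite (ext_d_contract_vec _ _ ak) (ext_d_contract_vec _ _ ak) ext_dE.
have -> : dsum (fun y t => frep p (contract_field (fun q => decomposable [:: Y q]) a) y
      (vect_rep (chart_at p) X y :: t)) (crd p) =
    dsum (fun y t => frep p a y (vect_rep (chart_at p) Y y ::
      vect_rep (chart_at p) X y :: t)) (crd p).
  apply: dsum_near => t; apply: filterS (nbhs_chart_img p) => y cy.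
  by rewrite (form_rep_contract_vec _ ak cy).
have := cartan_bracket s (fun y => form_rep_form p y ak) (form_field_diff p ak)
  (vect_field_diff p Xs) (vect_field_diff p Ys).
rewrite !vect_rep_at form_rep_at => h.
rewrite /lie_bracket -h /= expr2 expr1; ring.
Qed.

Lemma smooth_fun_diff (f : Z -> R) p : smooth_fun f ->
  differentiable (f \o coord_inv (chart_at p) : E -> R^o) (crd p).
Proof. by move=> fs; apply: (smooth_diff (fs (chart_at p))); exact: chart_img_crd. Qed.

Lemma ext_d_fun k (f : Z -> R) a p : smooth_fun f -> form_field k a ->
  ext_d (contract_field (mvec_of_fun f) a) p =
  f p *: ext_d a p + wsum (f \o coord_inv (chart_at p)) (a p) (crd p).
Proof.
move=> fs ak; apply/funext => s; toR; rewrite !regE !ext_dE.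
have -> : dsum (frep p (contract_field (mvec_of_fun f) a)) (crd p) =
    dsum (fun y => (f (coord_inv (chart_at p) y) : R) *: frep p a y) (crd p).
  apply: dsum_near => t; apply: filterS (nbhs_chart_img p) => y cy.
  by rewrite /form_rep (contract_mvec_of_fun _ _ ak).
have h := dsum_mul s (smooth_fun_diff p fs) (form_field_diff p ak).
rewrite [LHS]h /= form_rep_at coordK //; exact: dom_chart_at.
Qed.

(** In degree 0, [d (f a) - f d a] leaves the wedge product with df: an operator of order 0 in
    [a]. *)
Lemma lie_deriv_fun k (f : Z -> R) a p : smooth_fun f -> form_field k a ->
  lie_deriv 0 (mvec_of_fun f) a p =
  wsum (f \o coord_inv (chart_at p)) (a p) (crd p).
Proof.
move=> fs ak; rewrite lie_derivE (ext_d_fun _ fs ak) expr0 scale1r.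
have -> : contract (mvec_of_fun f p) (ext_d a p) = f p *: ext_d a p.
  apply/funext => t; toR; rewrite regE -[ext_d a p t]/(ext_d a p ([::] ++ t)).
  by rewrite -(contract_dec [::] t (is_form_ext_d p ak)).
by rewrite addrAC subrr add0r.
Qed.

Lemma form_field_fun k (f : Z -> R) a : smooth_fun f -> form_field k a ->
  form_field k (contract_field (mvec_of_fun f) a).
Proof.
by move=> fs ak; have := form_field_contractT (mvec_field_fun fs) ak; rewrite subn0.
Qed.

(** The wedge product with df commutes with multiplication by [g]. *)
Lemma comm_fun_fun k (f g : Z -> R) a p : smooth_fun f -> smooth_fun g ->
  form_field k a -> comm 0 0 (mvec_of_fun f) (mvec_of_fun g) a p = 0.
Proof.
move=> fs gs ak; apply/funext => t; rewrite /comm expr0 scale1r.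
rewrite (lie_deriv_fun _ fs (form_field_fun gs ak)) (lie_deriv_fun _ fs ak).
rewrite (contract_mvec_of_fun _ _ ak); toR; rewrite !regE wsumZ.
have wf : is_form (k.+1 - 0) (wsum (f \o coord_inv (chart_at p)) (a p) (crd p)).
  by rewrite -(lie_deriv_fun _ fs ak); exact: is_form_lie (mvec_field_fun fs) ak.
have -> : contract (mvec_of_fun g p) (wsum (f \o coord_inv (chart_at p)) (a p) (crd p)) t =
    g p * contract (decomposable [::]) (wsum (f \o coord_inv (chart_at p)) (a p) (crd p)) t by [].
by rewrite (contract_dec _ _ wf) /= subrr.
Qed.

(** Contraction is an antiderivation: [i_X] of the wedge of df with [a] is [X(f) a] minus the wedge
    of df with [i_X a], and the latter cancels in the commutator. *)
Lemma comm_fun_vect k (f : Z -> R) X a p : smooth_fun f -> vect_field X ->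
  form_field k a ->
  comm 0 1 (mvec_of_fun f) (fun q => decomposable [:: X q]) a p =
  - ('D_(X p) (f \o coord_inv (chart_at p) : E -> R^o) (crd p) : R) *: a p.
Proof.
move=> fs Xs ak; apply/funext => t; have Xf := vect_field_mvec Xs.
have Xak := form_field_contractT Xf ak.
rewrite /comm (lie_deriv_fun _ fs Xak) (lie_deriv_fun _ fs ak); toR; rewrite !regE.
have wf : is_form (k.+1 - 0) (wsum (f \o coord_inv (chart_at p)) (a p) (crd p)).
  by rewrite -(lie_deriv_fun _ fs ak); exact: is_form_lie (mvec_field_fun fs) ak.
rewrite (contract_dec _ _ wf) /= wsum_cons.
have -> : contract_field (fun q => decomposable [:: X q]) a p = fun t => a p (X p :: t).
  by apply/funext => u; rewrite /contract_field (contract_dec _ _ (form_fieldE p ak)).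
by rewrite /= expr1; ring.
Qed.

(** [h^2] vanishes to second order at p, so a first-order operator does not see [h^2 a] there. *)
Lemma ext_d_square k (h : Z -> R) a p : smooth_fun h -> h p = 0 -> form_field k a ->
  ext_d (contract_field (mvec_of_fun h) (contract_field (mvec_of_fun h) a)) p = 0.
Proof.
move=> hs h0 ak; rewrite (ext_d_fun _ hs (form_field_fun hs ak)) h0 scale0r add0r.
rewrite (contract_mvec_of_fun _ _ ak) h0 scale0r; apply/funext => t.
by rewrite /wsum big1 // => i _; rewrite [X in _ * (_ * X)](_ : _ = 0) ?mulr0.
Qed.

End FieldCalculus.

(** * The Schouten-Nijenhuis bracket *)

Section Bracket.
Variables (R : realType) (m : nat) (Z : manifold R m).
Local Notation E := 'rV[R]_m.
Local Notation dform := (dform R m).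
Local Notation mvec := (mvec R m).
Implicit Types (p q : Z) (a b : Z -> dform) (G : Z -> mvec) (X Y : Z -> E).
Implicit Types (f g h : Z -> R).
Local Notation crd p := (coord (chart_at p) p).
Local Notation vfield X := (fun q => decomposable [:: X q]).

Lemma open_chart_imgT (c : atlas Z) : open (chart_img c setT).
Proof. by apply: open_chart_img; exact: openT. Qed.

Lemma smooth_fun_mul f g : smooth_fun f -> smooth_fun g ->
  smooth_fun (fun q => f q * g q).
Proof. by move=> fs gs c; apply: smooth_mul; [exact: open_chart_imgT|exact: fs|exact: gs]. Qed.

Lemma smooth_fun_cst (t : R) : smooth_fun ((fun=> t) : Z -> R).
Proof. by move=> c; exact: smooth_cst. Qed.

Lemma smooth_funB f g : smooth_fun f -> smooth_fun g ->
  smooth_fun (fun q => f q - g q).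
Proof.
move=> fs gs c; apply: (smooth_eq (f := fun x => (f (coord_inv c x) : R^o) +
  -1 *: (g (coord_inv c x) : R^o))).
- exact: open_chart_imgT.
- by move=> x _; rewrite scaleN1r.
- apply: smooth_add; [exact: open_chart_imgT|exact: fs|].
  by apply: smooth_scale; [exact: open_chart_imgT|exact: gs].
Qed.

Lemma smooth_funX f n : smooth_fun f -> smooth_fun (fun q => f q ^+ n).
Proof.
move=> fs; elim: n => [|n IH]; first exact: smooth_fun_cst.
by have := smooth_fun_mul fs IH; under eq_fun do rewrite -exprS.
Qed.

Lemma vect_field_scale f X : smooth_fun f -> vect_field X ->
  vect_field (fun q => f q *: X q).
Proof.
move=> fs Xs c; rewrite -chart_imgT.
apply: (smooth_eq (f := fun x => (f (coord_inv c x)) *: vect_rep c X x)).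
- exact: open_chart_imgT.
- by move=> x _; rewrite /vect_rep to_chartZ.
- apply: (smooth_scalev (f := f \o coord_inv c)); first exact: open_chart_imgT.
    exact: fs.
  by rewrite chart_imgT; exact: Xs.
Qed.

Lemma dec_scale (c : R) (s : seq E) :
  decomposable [seq c *: v | v <- s] = c ^+ size s *: (decomposable s : mvec).
Proof.
apply/funext => b; toR; rewrite regE /decomposable size_map.
case: asboolP => [bs|_]; last by rewrite mulr0.
have bl := is_form_multilinear bs.
suff h t : b (t ++ [seq c *: v | v <- s]) = c ^+ size s * b (t ++ s) by exact: (h [::]).
elim: s t {bs} => [|v s IH] t; first by rewrite expr0 mul1r.
  rewrite /= exprS -mulrA -cat_rcons -[t ++ v :: s]cat_rcons -IH cat_rcons.
  have z : b (t ++ 0 :: [seq c *: v | v <- s]) = 0.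
    have := bl t [seq c *: v | v <- s] 1 0 0.
    by rewrite scale1r addr0; lra.
  have := bl t [seq c *: v | v <- s] c v 0; rewrite addr0 z addr0 => ->.
  by rewrite cat_rcons.
Qed.

Lemma dec_scale1 (c : R) (v : E) :
  decomposable [:: c *: v] = c *: (decomposable [:: v] : mvec).
Proof. exact: (dec_scale c [:: v]). Qed.

Lemma mvec_degree0 (H : mvec) : is_mvec 0 H ->
  exists t : R, H = t *: (decomposable [::] : mvec).
Proof.
move=> H0; pose one : dform := fun s => (s == [::])%:R.
have one0 : is_form 0 one.
  split=> [[|v s]|[|w s1] s2 c u v|[|w s1] s2 s3 u] //=; rewrite /one /= ?mulr0 ?addr0 //.
exists (H one); apply/funext => b; toR; rewrite regE.
have [b0|b0] := pselect (is_form 0 b); last first.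
  by case: H0 => _ ->; rewrite // /decomposable; case: asboolP => //; rewrite mulr0.
rewrite decomposableE // mulrC -(mvecZ _ H0 one0); congr (H _).
apply/funext => -[|v s]; toR; rewrite regE /one /= ?mulr1 // mulr0.
exact: (is_form_size b0).
Qed.

(** The constant 1-form dx_j, used to read an entry of [v] off [decomposable [:: v]]. *)
Definition coord_form (j : 'I_m) : dform := fun s => if s is [:: u] then u 0 j else 0.

Lemma is_form_coord j : is_form 1 (coord_form j).
Proof.
split=> [[|u [|v s]]|s1 s2 c u v|s1 s2 s3 u] //.
- case: s1 => [|w [|w' s1]]; case: s2 => [|w2 s2]; rewrite /= ?mulr0 ?addr0 //.
  by rewrite !mxE.
- by case: s1 => [|w [|w' s1]]; case: s2.
Qed.

Lemma lie_bracket_fun f X Y p : smooth_fun f -> vect_field X -> vect_field Y ->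
  lie_bracket X (fun q => f q *: Y q) p =
  ('D_(X p) (f \o coord_inv (chart_at p) : E -> R^o) (crd p) : R) *: Y p
  + f p *: lie_bracket X Y p.
Proof.
move=> fs Xs Ys; rewrite /lie_bracket.
have df := smooth_fun_diff p fs; have dY := vect_field_diff p Ys.
have dX := vect_field_diff p Xs; have dfY := vect_field_diff p (vect_field_scale fs Ys).
have cp := dom_chart_at p; set c := chart_at p.
have dYj j := differentiable_entry j dY.
apply/rowP => j; rewrite !mxE -!derive_entry // (deriveE _ (differentiable_entry j dX)).
rewrite -[X in 'd _ _ X]addr0 linearP linear0 addr0 -(deriveE _ (differentiable_entry j dX)).
have -> : (fun y => vect_rep c (fun q => f q *: Y q) y 0 j : R^o) =
    (f \o coord_inv c : E -> R^o) * (fun y => vect_rep c Y y 0 j : R^o).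
  by apply/funext => y; rewrite /vect_rep to_chartZ mxE.
rewrite deriveM; [|exact: diff_derivable|exact: diff_derivable].
rewrite !derive_entry // vect_rep_at /= coordK // -![_ *: _]/(_ * _); ring.
Qed.

Lemma lie_derivP r k (c : R) G a b p : mvec_field r G -> form_field k a ->
  form_field k b ->
  lie_deriv r G (c *: a + b) p = c *: lie_deriv r G a p + lie_deriv r G b p.
Proof.
move=> Gr ak bk; rewrite !lie_derivE.
have -> : contract_field G (c *: a + b) = c *: contract_field G a + contract_field G b.
  apply/funext => q.
  exact: (contractP c (mvec_fieldE q Gr) (form_fieldE q ak) (form_fieldE q bk)).
rewrite (ext_d_linear c p (form_field_contractT Gr ak) (form_field_contractT Gr bk)).
rewrite (ext_d_linear c p ak bk).
rewrite (contractP c (mvec_fieldE p Gr) (is_form_ext_d p ak) (is_form_ext_d p bk)).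
by apply/funext => t; toR; rewrite !regE; ring.
Qed.

Lemma lie_deriv0 r G p : mvec_field r G -> lie_deriv r G 0 p = 0.
Proof.
(* With scalar -1 and zero forms, linearity reads L 0 = - L 0 + L 0. *)
move=> Gr; have := lie_derivP (-1) p Gr (form_field0 Z 0) (form_field0 Z 0).
by rewrite scaler0 addr0 scaleN1r addNr.
Qed.

Lemma comm_linear r s k (c : R) G G1 G2 a p : mvec_field r G ->
  mvec_field s G1 -> mvec_field s G2 -> form_field k a ->
  comm r s G (c *: G1 + G2) a p = c *: comm r s G G1 a p + comm r s G G2 a p.
Proof.
move=> Gr G1s G2s ak; rewrite /comm.
have -> : contract_field (c *: G1 + G2) a =
    c *: contract_field G1 a + contract_field G2 a by [].
rewrite (lie_derivP c p Gr (form_field_contractT G1s ak) (form_field_contractT G2s ak)).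
have -> : contract ((c *: G1 + G2) p) (lie_deriv r G a p) =
  c *: contract (G1 p) (lie_deriv r G a p) + contract (G2 p) (lie_deriv r G a p) by [].
by apply/funext => t; toR; rewrite !regE; ring.
Qed.

Lemma is_form_lie_contract r l k G G' a p : mvec_field r G -> mvec_field l G' ->
  form_field k a -> is_form (k.+1 - r - l) (lie_deriv r G (contract_field G' a) p).
Proof.
move=> Gr Gl ak; have [lk|kl] := leqP l k.
  have := is_form_lie p Gr (form_field_contractT Gl ak).
  by rewrite -subSn // subnAC.
have -> : contract_field G' a = 0.
  apply/funext => q; apply: (contract_small (mvec_fieldE q Gl) (form_fieldE q ak)).
  exact: kl.
by rewrite (lie_deriv0 _ Gr); exact: is_form0.
Qed.

(** As a wedge contracts successively, inserting and subtracting the signed term [i_G'' L_G i_G']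
    splits the commutator into two. *)
Lemma comm_wedge r l j k G G' G'' a p : mvec_field r G -> mvec_field l G' ->
  mvec_field j G'' -> form_field k a ->
  comm r (l + j) G (fun q => wedge l j (G' q) (G'' q)) a p =
  contract (G'' p) (comm r l G G' a p)
  + (-1) ^+ (r.+1 * l) *: comm r j G G'' (contract_field G' a) p.
Proof.
move=> Gr Gl Gj ak; rewrite /comm.
have lp := mvec_fieldE p Gl; have jp := mvec_fieldE p Gj.
have la := is_form_lie p Gr ak; have lia := is_form_lie_contract p Gr Gl ak.
rewrite (contractB jp (is_formZ _ lia) (is_form_contract lp la)).
rewrite (contractZ _ jp lia) (contract_wedge lp jp la).
have -> : contract_field (fun q => wedge l j (G' q) (G'' q)) a =
    contract_field G'' (contract_field G' a).
  apply/funext => q.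
  exact: (contract_wedge (mvec_fieldE q Gl) (mvec_fieldE q Gj) (form_fieldE q ak)).
by apply/funext => t; toR; rewrite !regE mulnDr exprD; ring.
Qed.

Lemma mvec_fieldPT k (c : R) G G' : mvec_field k G -> mvec_field k G' ->
  mvec_field k (c *: G + G').
Proof. by apply: mvec_fieldP; exact: openT. Qed.

Lemma mvec_field0T k : mvec_field k (0 : Z -> mvec).
Proof. by apply: mvec_field0; exact: openT. Qed.

Lemma mvec_field_wedgeT k l G G' : mvec_field k G -> mvec_field l G' ->
  mvec_field (k + l) (fun q => wedge k l (G q) (G' q)).
Proof. by apply: mvec_field_wedge; exact: openT. Qed.

Lemma wedge_mvec_of_fun f s G : mvec_field s G ->
  (fun q => wedge 0 s (mvec_of_fun f q) (G q)) = fun q => f q *: G q.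
Proof. by move=> Gs; apply/funext => q; rewrite wedge_fun //; exact: mvec_fieldE Gs. Qed.

Lemma mvec_field_scale f s G : smooth_fun f -> mvec_field s G ->
  mvec_field s (fun q => f q *: G q).
Proof.
move=> fs Gs; rewrite -(wedge_mvec_of_fun f Gs).
by have := mvec_field_wedgeT (mvec_field_fun fs) Gs.
Qed.

(** * Contraction with the Schouten-Nijenhuis bracket *)

Section SchoutenNijenhuis.
Variable br : nat -> nat -> (Z -> mvec) -> (Z -> mvec) -> (Z -> mvec).
Hypothesis brP : schouten_nijenhuis br.

(** The degree of [a] is quantified because the wedge step uses the rule for [i_G' a] as well; p is
    fixed because the bump function of [bracket_rule_extend] depends on it. *)
Definition bracket_rule p r s G G' := forall k a, form_field k a ->
  contract (br r s G G' p) (a p) = comm r s G G' a p.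

Lemma bracket_rule_sym p r s G G' : mvec_field r G -> mvec_field s G' ->
  bracket_rule p r s G G' -> bracket_rule p s r G' G.
Proof.
move=> Gr Gs rule k a ak; rewrite (comm_sym p Gs Gr ak) -(rule _ _ ak).
by rewrite (sn_antisym brP Gs Gr).
Qed.

Lemma bracket_rule_linear p r s (c : R) G G1 G2 : mvec_field r G ->
  mvec_field s G1 -> mvec_field s G2 ->
  bracket_rule p r s G G1 -> bracket_rule p r s G G2 ->
  bracket_rule p r s G (c *: G1 + G2).
Proof.
move=> Gr G1s G2s rule1 rule2 k a ak.
rewrite (comm_linear c p Gr G1s G2s ak) -(rule1 _ _ ak) -(rule2 _ _ ak).
by rewrite (sn_linearr brP c Gr G1s G2s).
Qed.

Lemma bracket_rule0 p r s G : mvec_field r G -> bracket_rule p r s G 0.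
Proof.
move=> Gr k a ak; have := sn_linearr brP (-1) Gr (mvec_field0T s) (mvec_field0T s).
rewrite scaler0 addr0 scaleN1r addNr => ->.
have := comm_linear (-1) p Gr (mvec_field0T s) (mvec_field0T s) ak.
by rewrite scaler0 addr0 scaleN1r addNr => ->.
Qed.

Lemma bracket_rule_wedge p r l j G G' G'' : mvec_field r G ->
  mvec_field l G' -> mvec_field j G'' ->
  bracket_rule p r l G G' -> bracket_rule p r j G G'' ->
  bracket_rule p r (l + j) G (fun q => wedge l j (G' q) (G'' q)).
Proof.
move=> Gr Gl Gj rule1 rule2 k a ak.
rewrite (comm_wedge p Gr Gl Gj ak) -(rule1 _ _ ak).
rewrite -(rule2 _ _ (form_field_contractT Gl ak)) (sn_leibniz brP Gr Gl Gj).
have ap := form_fieldE p ak.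
have rl := mvec_fieldE p (sn_field brP Gr Gl).
have rj := mvec_fieldE p (sn_field brP Gr Gj).
rewrite -(contract_wedge rl (mvec_fieldE p Gj) ap).
by rewrite /contract_field -(contract_wedge (mvec_fieldE p Gl) rj ap).
Qed.

Lemma bracket_rule_fun_fun p f g : smooth_fun f -> smooth_fun g ->
  bracket_rule p 0 0 (mvec_of_fun f) (mvec_of_fun g).
Proof.
move=> fs gs k a ak; rewrite (comm_fun_fun p fs gs ak).
by rewrite (sn_functions brP (mvec_field_fun fs) (mvec_field_fun gs)).
Qed.

Lemma bracket_rule_vect_vect p X Y : vect_field X -> vect_field Y ->
  bracket_rule p 1 1 (vfield X) (vfield Y).
Proof.
by move=> Xs Ys k a ak; rewrite (comm_vect p Xs Ys ak) (sn_vectors brP Xs Ys).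
Qed.

(* Compare the two expressions of the bracket of X with f Y, given by the
   Leibniz rule and by the Lie bracket, at a point where Y does not vanish. *)
Lemma bracket_vect_fun p X f : (0 < m)%N -> vect_field X -> smooth_fun f ->
  br 1 0 (vfield X) (mvec_of_fun f) p =
  ('D_(X p) (f \o coord_inv (chart_at p) : E -> R^o) (crd p) : R) *:
    (decomposable [::] : mvec).
Proof.
move=> m0 Xs fs; pose j : 'I_m := Ordinal m0.
have [Y Ys Yp] := vect_field_through p (delta_mx 0 j).
have Xf := vect_field_mvec Xs; have Yf := vect_field_mvec Ys.
have ff := mvec_field_fun fs.
have [t tE] := mvec_degree0 (mvec_fieldE p (sn_field brP Xf ff)).
rewrite tE; congr (_ *: _).
have := sn_leibniz brP Xf ff Yf; rewrite (wedge_mvec_of_fun f Yf).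
have -> : (fun q => f q *: (decomposable [:: Y q] : mvec)) =
    vfield (fun q => f q *: Y q).
  by apply/funext => q; rewrite dec_scale1.
rewrite (sn_vectors brP Xs (vect_field_scale fs Ys)) (sn_vectors brP Xs Ys).
(* As [Y p] is the [j]-th basis vector, evaluation on dx_j compares [t] with X(f); the contributions
   of [f p] times [X, Y] agree. *)
move=> /(congr1 (fun G => G p (coord_form j))).
have d1 v : is_mvec 1 (decomposable [:: v] : mvec) by exact: (is_mvec_decomposable [:: v]).
have cf := is_form_coord j.
rewrite (lie_bracket_fun p fs Xs Ys) decomposableE // => h.
have {h} : coord_form j [:: 'D_(X p) (f \o coord_inv (chart_at p) : E -> R^o) (crd p) *: Y p
      + f p *: lie_bracket X Y p] =
    wedge 0 1 (br 1 0 (vfield X) (mvec_of_fun f) p) (decomposable [:: Y p]) (coord_form j)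
    + (-1) ^+ (2 * 0) * wedge 0 1 (f p *: (decomposable [::] : mvec))
        (decomposable [:: lie_bracket X Y p]) (coord_form j) := h.
rewrite tE !wedge_fun // !regE !decomposableE //=.
rewrite !mxE Yp !mxE !eqxx /= muln0 expr0; lra.
Qed.

Lemma bracket_rule_fun_vect p f X : (0 < m)%N -> smooth_fun f -> vect_field X ->
  bracket_rule p 0 1 (mvec_of_fun f) (vfield X).
Proof.
move=> m0 fs Xs k a ak; rewrite (comm_fun_vect p fs Xs ak).
have Xf := vect_field_mvec Xs; have ff := mvec_field_fun fs.
rewrite (sn_antisym brP ff Xf).
have -> : (- ((-1) ^+ (1 * 2) *: br 1 0 (vfield X) (mvec_of_fun f))) p =
    - ((-1) ^+ (1 * 2) *: br 1 0 (vfield X) (mvec_of_fun f) p) by [].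
rewrite (bracket_vect_fun p m0 Xs fs) mul1n sqrrN expr1n scale1r.
apply/funext => t; toR; rewrite regE -[a p t]/(a p ([::] ++ t)).
by rewrite -(contract_dec [::] t (form_fieldE p ak)) mulNr.
Qed.

(* The bracket with h^2 G' vanishes where h does; so does [comm]. *)
Lemma bracket_rule_square p r s h G G' : mvec_field r G -> mvec_field s G' ->
  smooth_fun h -> h p = 0 ->
  bracket_rule p r s G (fun q => h q *: (h q *: G' q)).
Proof.
move=> Gr Gs hs h0 k a ak; have hf := mvec_field_fun hs.
have hGs := mvec_field_scale hs Gs.
rewrite -[X in br r s G X](wedge_mvec_of_fun h hGs).
(* [h^2 G'] is read as the wedge of the degree 0 field [h] with [h G']: each of the two Leibniz
   terms keeps an undifferentiated factor [h], which is 0 at p. *)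
rewrite -[br r s G _]/(br r (0 + s) G _) (sn_leibniz brP Gr hf hGs).
have w0 (H : mvec) u v : is_mvec u H -> wedge u v H 0 = 0.
  move=> Hu; apply/funext => b; rewrite /wedge; case: asboolP => // _.
  exact: mvec0 Hu.
have w0l (H : mvec) u v : wedge u v 0 H = 0.
  by apply/funext => b; rewrite /wedge; case: asboolP.
rewrite /comm.
set A := (X in contract (X p) (a p)).
have -> : A p = 0.
  have mh : mvec_of_fun h p = 0 by rewrite /mvec_of_fun h0 scale0r.
  have -> : A p = wedge (r + 0).-1 s (br r 0 G (mvec_of_fun h) p) (h p *: G' p)
    + (-1) ^+ (r.+1 * 0) *: wedge 0 (r + s).-1 (mvec_of_fun h p)
        (br r s G (fun q => h q *: G' q) p) by [].
  rewrite mh h0 scale0r w0l scaler0 addr0.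
  by apply: w0; exact: mvec_fieldE (sn_field brP Gr hf).
have -> : contract_field (fun q => h q *: (h q *: G' q)) a =
    contract_field (mvec_of_fun h) (contract_field (mvec_of_fun h) (contract_field G' a)).
  have G'ak := form_field_contractT Gs ak.
  apply/funext => q; rewrite (contract_mvec_of_fun _ _ (form_field_fun hs G'ak)).
  by rewrite (contract_mvec_of_fun _ _ G'ak).
have G'ak := form_field_contractT Gs ak; set b := contract_field G' a in G'ak *.
have -> : lie_deriv r G (contract_field (mvec_of_fun h) (contract_field (mvec_of_fun h) b)) p = 0.
  rewrite lie_derivE (ext_d_square hs h0 G'ak).
  have -> : contract_field G (contract_field (mvec_of_fun h) (contract_field (mvec_of_fun h) b)) =
      contract_field (mvec_of_fun h) (contract_field (mvec_of_fun h) (contract_field G b)).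
    have hb := form_field_fun hs G'ak.
    rewrite (contract_field_comm Gr hf hb) (contract_field_comm Gr hf G'ak).
    by rewrite muln0 expr0 !scale1r.
  rewrite (ext_d_square hs h0 (form_field_contractT Gr G'ak)).
  have -> : contract (G p) 0 = 0 by apply/funext => t; exact: mvec0 (mvec_fieldE p Gr).
  by rewrite scaler0 subr0.
by rewrite h0 scale0r scaler0 subr0.
Qed.

(** The empty wedge is the constant function 1, and each further vector field is one Leibniz step.
    Smoothness is proved jointly because that step asks for it. *)
Lemma bracket_rule_dec p r G (I : Type) (X : I -> Z -> E) (l : seq I) :
  mvec_field r G ->
  (forall f, smooth_fun f -> bracket_rule p r 0 G (mvec_of_fun f)) ->
  (forall X, vect_field X -> bracket_rule p r 1 G (vfield X)) ->
  (forall i, vect_field (X i)) ->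
  mvec_field (size l) (fun q => decomposable [seq X i q | i <- l]) /\
  bracket_rule p r (size l) G (fun q => decomposable [seq X i q | i <- l]).
Proof.
move=> Gr rulef ruleX Xs; elim: l => [|i l [IHf IH]].
  have -> : (fun q => decomposable [seq X i q | i <- [::]]) = mvec_of_fun (fun=> 1).
    by apply/funext => q; rewrite /mvec_of_fun scale1r.
  split; [apply: mvec_field_fun|apply: rulef]; exact: smooth_fun_cst.
have e : (fun q => decomposable [seq X i q | i <- i :: l]) =
    fun q => wedge 1 (size l) (decomposable [:: X i q])
               (decomposable [seq X i q | i <- l]).
  apply/funext => q; have := wedge_dec [:: X i q] [seq X i q | i <- l].
  by rewrite size_map => ->.
have Xf := vect_field_mvec (Xs i).
rewrite e; split; first exact: (mvec_field_wedgeT Xf IHf).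
by apply: (bracket_rule_wedge Gr Xf IHf) => //; exact: ruleX.
Qed.

Lemma bracket_rule_sum p r s (I : Type) (l : seq I) G (F : I -> Z -> mvec) :
  mvec_field r G -> (forall i, mvec_field s (F i)) ->
  (forall i, bracket_rule p r s G (F i)) ->
  mvec_field s (\sum_(i <- l) F i) /\ bracket_rule p r s G (\sum_(i <- l) F i).
Proof.
move=> Gr Fs rule; elim: l => [|i l [IHf IH]].
  by rewrite big_nil; split; [exact: mvec_field0T|exact: bracket_rule0].
rewrite big_cons -[F i]scale1r; split; first exact: mvec_fieldPT.
exact: bracket_rule_linear.
Qed.

(* With chi a bump function at p and h = 1 - chi^(s+1), the field (1 - h^2) G'
   is a global combination of wedge products of globally defined vector fields,
   and h^2 G' does not contribute at p. *)
Lemma bracket_rule_extend p r s G G' : mvec_field r G -> mvec_field s G' ->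
  (forall f, smooth_fun f -> bracket_rule p r 0 G (mvec_of_fun f)) ->
  (forall X, vect_field X -> bracket_rule p r 1 G (vfield X)) ->
  bracket_rule p r s G G'.
Proof.
move=> Gr Gs rulef ruleX.
have [chi [chip chi0 chif chiv]] := chart_bump p.
set c := chart_at p in chi0 chif chiv.
have chis : smooth_fun chi.
  have := chif (fun=> 1) (smooth_cst _); rewrite (_ : (fun q => _) = chi) //.
  by apply/funext => q; rewrite mulr1.
(* The exponent counts the cut-offs in [F i]: one in each of the [s] vector fields [Xc v], and one
   in the coefficient [fi i]. *)
pose w q := chi q ^+ s.+1; pose h q := 1 - w q.
have ws : smooth_fun w by exact: smooth_funX.
have hs : smooth_fun h by apply: smooth_funB => //; exact: smooth_fun_cst.
have hp : h p = 0 by rewrite /h /w chip expr1n subrr.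
(* The factor [2 - w] is chosen so that [w (2 - w) = 1 - h^2]. *)
pose gi (i : 'I_(nbasis R m s)) (x : E) : R^o :=
  (2 - w (coord_inv c x)) * mvec_rep c G' x (bform i).
have gis i : smooth_on (chart_img c setT) (gi i).
  apply: smooth_mul; first exact: open_chart_imgT.
    by have := smooth_funB (smooth_fun_cst 2) ws; apply.
  by case: Gs => _; apply; exact: is_form_bform.
pose fi i q := chi q * gi i (coord c q).
have fis i : smooth_fun (fi i) by exact: chif (gis i).
pose Xc (v : E) q := chi q *: of_chart c q v.
have dX i := bracket_rule_dec (@bvec R m s i) Gr rulef ruleX chiv.
pose F i : Z -> mvec := fun q => fi i q *: decomposable [seq Xc v q | v <- bvec i].
have dXs i : mvec_field s (fun q => decomposable [seq Xc v q | v <- @bvec R m s i]).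
  by case: (dX i); rewrite size_bvec.
have Fs i : mvec_field s (F i) by exact: mvec_field_scale.
have Fr i : bracket_rule p r s G (F i).
  rewrite /F -(wedge_mvec_of_fun (fi i) (dXs i)).
  have := bracket_rule_wedge Gr (mvec_field_fun (fis i)) (dXs i); rewrite add0n; apply.
    exact: rulef.
  by case: (dX i); rewrite size_bvec.
have [Sf Sr] := bracket_rule_sum (index_enum _) Gr Fs Fr.
have G'E : G' = 1 *: (\sum_i F i) + fun q => h q *: (h q *: G' q).
  apply/funext => q; rewrite scale1r.
  have -> : (\sum_i F i + fun q => h q *: (h q *: G' q)) q =
      (\sum_i F i) q + h q *: (h q *: G' q) by [].
  (* Off the chart, [chi] is 0, so [h = 1] and the term in [h^2] is all of [G']. *)
  rewrite fct_sumE; have [cq|cq] := pselect (dom c q); last first.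
    rewrite big1 => [|i _]; last by rewrite /F /fi chi0 // mul0r scale0r.
    by rewrite /h /w chi0 // expr0n /= subr0 !scale1r add0r.
  have -> : \sum_i F i q = (w q * (2 - w q)) *: G' q.
    rewrite [in RHS](mvec_chart_basis cq (mvec_fieldE q Gs)) scaler_sumr.
    apply: eq_bigr => i _; rewrite /F /fi /gi /Xc /mvec_rep coordK //.
    have -> : [seq chi q *: of_chart c q v | v <- @bvec R m s i] =
      [seq chi q *: v | v <- [seq of_chart c q v | v <- bvec i]] by rewrite -map_comp.
    rewrite dec_scale size_map size_bvec !scalerA; congr (_ *: _).
    by rewrite /w exprS; ring.
  rewrite scalerA -scalerDl (_ : w q * (2 - w q) + h q * h q = 1) ?scale1r //.
  by rewrite /h; ring.
rewrite G'E; apply: bracket_rule_linear => //.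
  exact: mvec_field_scale (mvec_field_scale _ _).
exact: bracket_rule_square.
Qed.

(** [bracket_rule_extend] frees the second argument only. It is applied with a function, then with a
    vector field, as first argument; antisymmetry turns these results into the hypotheses needed for
    an arbitrary first argument. *)
Theorem bracket_contract p r s G G' : (0 < m)%N -> mvec_field r G ->
  mvec_field s G' -> bracket_rule p r s G G'.
Proof.
move=> m0 Gr Gs.
have funL f H u : smooth_fun f -> mvec_field u H -> bracket_rule p 0 u (mvec_of_fun f) H.
  move=> fs Hu; apply: (bracket_rule_extend (mvec_field_fun fs) Hu) => [g gs|X Xs].
    exact: bracket_rule_fun_fun.
  exact: bracket_rule_fun_vect.
have vectL X H u : vect_field X -> mvec_field u H -> bracket_rule p 1 u (vfield X) H.
  move=> Xs Hu; have Xf := vect_field_mvec Xs.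
  apply: (bracket_rule_extend Xf Hu) => [g gs|Y Ys].
    exact: (bracket_rule_sym (mvec_field_fun gs) Xf (funL _ _ _ gs Xf)).
  exact: bracket_rule_vect_vect.
apply: (bracket_rule_extend Gr Gs) => [f fs|X Xs].
  exact: (bracket_rule_sym (mvec_field_fun fs) Gr (funL _ _ _ fs Gr)).
exact: (bracket_rule_sym (vect_field_mvec Xs) Gr (vectL _ _ _ Xs Gr)).
Qed.

End SchoutenNijenhuis.
End Bracket.

(** * Integrability *)

Section Integrability.
Variables (R : realType) (m n : nat) (Z : manifold R m).
Local Notation E := 'rV[R]_m.
Local Notation dform := (dform R m).
Local Notation mvec := (mvec R m).
Variable br : nat -> nat -> (Z -> mvec) -> (Z -> mvec) -> (Z -> mvec).
Variable Omega : Z -> dform.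
Hypothesis Omega_form : form_field n.+1 Omega.

Definition graph_section (G : Z -> mvec) : Z -> mvec * dform :=
  fun q => (G q, contract_field G Omega q).

Lemma graph_sectionP r (x : Z -> mvec * dform) :
  section_of n (graph_dirac Omega) r x <->
  exists2 G, mvec_field r G & x = graph_section G.
Proof.
split=> [[[Gr _] xD]|[G Gr ->]].
  exists (fst \o x) => //; apply/funext => q.
  by have [G _ xE] := xD q; rewrite /graph_section /contract_field /= xE.
split; last by move=> q; exists (G q) => //; exact: mvec_fieldE Gr.
by split=> //; exact: (form_field_contractT Gr Omega_form).
Qed.

(** The two halves of the plus pairing coincide, so it equals [i_G' i_G Omega]. Its derivative
    cancels the exact part of [L_G' i_G Omega], leaving [- i_G' d i_G Omega], in which [d i_G] is
    rewritten as [L_G + (-1)^r i_G d]. *)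
Lemma courant_graph r s (G G' : Z -> mvec) p : (0 < r)%N -> (r + s <= n.+1)%N ->
  mvec_field r G -> mvec_field s G' ->
  courant n br r s (graph_section G) (graph_section G') p =
  (br r s G G' p, comm r s G G' Omega p
     - (-1) ^+ r *: contract (G' p) (contract (G p) (ext_d Omega p))).
Proof.
move=> r0 rs Gr Gs; rewrite /courant rs; congr (_, _).
have -> : (fun q => pairing 1 r s (graph_section G q) (graph_section G' q)) =
    contract_field G' (contract_field G Omega).
  apply/funext => q; rewrite /pairing /graph_section /= mul1r.
  rewrite -[contract (G q) _]/(contract_field G (contract_field G' Omega) q).
  rewrite (contract_field_comm Gr Gs Omega_form).
  apply/funext => t; toR; rewrite !regE mulrA -expr2 sqrr_sign mul1r.
  by rewrite -[contract _ _ t]/(contract_field G' (contract_field G Omega) q t); lra.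
rewrite -[fst \o graph_section G]/G -[fst \o graph_section G']/G'.
rewrite -[snd \o graph_section G]/(contract_field G Omega).
rewrite -[snd \o graph_section G']/(contract_field G' Omega).
rewrite (lie_derivE s) /comm [lie_deriv r G Omega p]lie_derivE.
have dO := is_form_ext_d p Omega_form.
have Gp := mvec_fieldE p Gr; have G'p := mvec_fieldE p Gs.
have f2 := is_form_contract Gp dO.
have f1 : is_form (n.+2 - r) (ext_d (contract_field G Omega) p).
  have := is_form_lie p Gr Omega_form; rewrite lie_derivE => h.
  rewrite -[ext_d _ _](subrK ((-1) ^+ r *: contract (G p) (ext_d Omega p))).
  by apply: is_formD => //; exact: is_formZ.
rewrite (contractB G'p f1 (is_formZ _ f2)) (contractZ _ G'p f2).
apply/funext => t; toR; rewrite !regE.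
(* [r.-1] and [r.+1] have the same parity only for [r > 0]. *)
have -> : (-1) ^+ (r.-1 * s) = (-1) ^+ (r.+1 * s) :> R.
  case: r r0 {Gr Gp f1 f2 rs} => // r _ /=; rewrite (sign_odd R (r * s)).
  by rewrite (sign_odd R (r.+2 * s)) !oddM /= negbK.
have ss : (-1) ^+ s * (-1) ^+ s = 1 :> R by rewrite -expr2 sqrr_sign.
rewrite [X in _ + X - _ = _]mulrBr [(-1) ^+ s * ((-1) ^+ s * _)]mulrA ss; ring.
Qed.

End Integrability.

Theorem proposition4p2 (R : realType) (m n : nat) (Z : manifold R m)
    (br : nat -> nat -> (Z -> mvec R m) -> (Z -> mvec R m) -> (Z -> mvec R m))
    (Omega : Z -> dform R m) :
  schouten_nijenhuis br ->
  (1 <= n <= m)%N ->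
  form_field n.+1 Omega ->
  multi_dirac n (graph_dirac Omega) /\
  (integrable_dirac n br (graph_dirac Omega) <-> ext_d Omega = 0%R).
Proof.
move=> brP /andP[n0 nm] Of; split; first exact: multi_dirac_graph.
have m0 : (0 < m)%N by exact: leq_trans nm.
split=> [int|dO0].
  apply/funext => p; apply/funext => t.
  have dO := is_form_ext_d p Of.
  (* Lists with fewer than two vectors are below the degree [n.+2] of [ext_d Omega]. *)
  case: t => [|v [|w t]]; try exact: (is_form_size dO).
  have [X Xs Xp] := vect_field_through p v.
  have [Y Ys Yp] := vect_field_through p w.
  have Xf := vect_field_mvec Xs; have Yf := vect_field_mvec Ys.
  (* Degrees 1 and 1 are admissible since [n >= 1]. The first component of the bracket determines
     its second one in the graph, so the defect [i_Y i_X d Omega] is 0 at p; its value at [t] is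
     that of [ext_d Omega] at [v :: w :: t]. *)
  have := int 1 1 n0 n0 _ _
    ((graph_sectionP Of 1 _).2 (ex_intro2 _ _ _ Xf erefl))
    ((graph_sectionP Of 1 _).2 (ex_intro2 _ _ _ Yf erefl)).
  rewrite ltnS n0 => -[_ /(_ p)[H _]].
  rewrite (courant_graph br Of) // => -[<-].
  rewrite (bracket_contract brP p m0 Xf Yf Of) expr1 scaleN1r opprK.
  move=> /(congr1 (fun b : dform R m => b t)) /=; rewrite regE => /eqP.
  rewrite -subr_eq0 addrAC subrr add0r => /eqP.
  have dX := is_form_contract (mvec_fieldE p Xf) dO.
  by rewrite (contract_dec _ _ dX) (contract_dec _ _ dO) /= Xp Yp.
move=> r s /andP[r0 rn] /andP[s0 sn] x y /(graph_sectionP Of)[G Gr ->].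
move=> /(graph_sectionP Of)[G' Gs ->]; case: ifP => rs; last by rewrite /courant rs.
apply/(graph_sectionP Of); exists (br r s G G'); first exact: sn_field.
apply/funext => p; rewrite (courant_graph br Of) // dO0.
have z (k : nat) (H : mvec R m) : is_mvec k H -> contract H 0 = 0.
  by move=> Hk; apply/funext => t; exact: mvec0 Hk.
rewrite (z r) ?(z s) ?scaler0 ?subr0; try exact: mvec_fieldE Gr.
  by rewrite -(bracket_contract brP p m0 Gr Gs Of).
exact: mvec_fieldE Gs.
Qed.
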